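(* Consider the feedback interconnection of the traffic dynamics $$\dot\rho_i = L_i^{-1}\Big(-w_{ii}g_i(\rho_i)-\sum_{l\in\mathcal{S}_i}w_{il}g_i(\rho_i)+\sum_{j\in\mathcal{P}_i}w_{ji}g_j(\rho_j)+u_i\Big),\quad i\in\mathcal{N},$$ with the decentralized control (vehicular admission control, VAC) dynamics $$\dot x_{\rho_i}=\chi_{\rho_i}(x_{\rho_i},-\rho_i),\qquad u_i=y_{\rho_i}(x_{\rho_i},-\rho_i),\quad i\in\mathcal{N},$$ where all the data satisfy the standing assumptions listed in the context. Let $(\boldsymbol{x}_{\boldsymbol\rho}^*,\boldsymbol\rho^* )$ be an equilibrium of this interconnection (as defined in the context) with $-\rho_i^*\in(-\rho_i^J,0)$ for all $i\in\mathcal{N}$, and suppose that for each $i\in\mathcal{N}$ the VAC dynamics are locally input strictly passive about $(x_{\rho_i}^*,-\rho_i^* )$ (as defined in the context), with associated constant $\eta_i>0$. For $(j,i)\in\mathcal{E}$ let $$a_{ji}=w_{ji}\,(r_jv_j^L+v_j^{d,L}).$$ If there exist $\xi_{ji}>0$, $(j,i)\in\mathcal{E}$, such that $$\eta_i> v_i^{d,L}+r_iv_i^L+\sum_{j\in\mathcal{P}_i}\frac{a_{ji}}{2\xi_{ji}}+\sum_{j\in\mathcal{S}_i}\frac{\xi_{ij}a_{ij}}{2}\qquad\text{for all } i\in\mathcal{N},$$ then there exists an open neighbourhood $\bar{\mathcal{M}}$ of the considered equilibrium such that solutions of the interconnection initiated in $\bar{\mathcal{M}}$ asymptotically converge to the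 set of equilibrium points of the interconnection.
   Context: **Notation.** $\mathbb{R}_+$ denotes the non-negative reals. A function $\theta:\mathbb{R}\to\mathbb{R}$ is positive definite if $\theta(0)=0$ and $\theta(x)>0$ for $x\ne0$. **Traffic network.** $\mathcal{G}=(\mathcal{N},\mathcal{E})$ is a connected directed graph with $\mathcal{N}=\{1,\dots,n\}$, $n\ge2$, $\mathcal{E}\subseteq\mathcal{N}\times\mathcal{N}$. Set $\mathcal{P}_i=\{j\in\mathcal{N}:(j,i)\in\mathcal{E}\}$ and $\mathcal{S}_i=\{l\in\mathcal{N}:(i,l)\in\mathcal{E}\}$. The state $\rho_i\in[0,\rho_i^J]$ is the vehicle density of region $i$, with jam density $\rho_i^J>0$; $L_i>0$ is the region length, $l_i>0$ the average trip length, and $r_i=L_i/l_i$. The constants $w_{ii},w_{il}\in\mathbb{R}_+$ satisfy $w_{ii}+\sum_{l\in\mathcal{S}_i}w_{il}=1$ for every $i\in\mathcal{N}$. The flow function is $g_i(\rho_i)=r_if_i(\rho_i)+d_i(\rho_i)$, where: - $f_i:[0,\rho_i^J]\to\mathbb{R}_+$ is bounded, of the form $f_i(\rho_i)=\rho_i\psi_i(\rho_i)$ (with $\psi_i$ the vehicle speed), concave on $[0,\rho_i^J]$ with a unique maximum at some $\rho_i^{C,f}\in(0,\rho_i^J)$, and Lipschitz with constant $v_i^L$: $|f_i(x)-f_i(y)|\le v_i^L|x-y|$ for all $x,y\in[0,\rho_i^J]$. - $d_i:[0,\rho_i^J]\to\mathbb{R}$ (modelling uncertainty) is bounded and Lipschitz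 with constant $v_i^{d,L}\in\mathbb{R}_+$, satisfies $d_i(\rho_i)\ge -r_if_i(\rho_i)$ for all $\rho_i$, and is such that $g_i$ is concave with a unique maximum, attained at some $\rho_i^{C,g}$. **VAC dynamics.** For each $i$, $\chi_{\rho_i}:\mathbb{R}^{n_i}\times[-\rho_i^J,0]\to\mathbb{R}^{n_i}$ is locally Lipschitz and $y_{\rho_i}:\mathbb{R}^{n_i}\times[-\rho_i^J,0]\to\mathbb{R}$ is continuous. It is assumed that for any constant input $\rho_i(t)=\bar\rho_i$ there is a unique state $x_{\rho_i}^*$ with $\chi_{\rho_i}(x_{\rho_i}^*,-\bar\rho_i)=0$, and that $x_{\rho_i}^*$ is a locally asymptotically stable equilibrium of $\dot x_{\rho_i}=\chi_{\rho_i}(x_{\rho_i},-\bar\rho_i)$; the corresponding output is $\bar u_i=y_{\rho_i}(x_{\rho_i}^*,-\bar\rho_i)$. The static characteristic maps are $k_i^u(-\bar\rho_i)=x_{\rho_i}^*$ and $k_i^{u,y}(-\bar\rho_i)=y_{\rho_i}(k_i^u(-\bar\rho_i),-\bar\rho_i)$. **Equilibrium of the interconnection.** A point $(\boldsymbol{x}_{\boldsymbol\rho}^*,\boldsymbol\rho^* )$, with $\boldsymbol{x}_{\boldsymbol\rho}^*=(x_{\rho_i}^* )_{i}\in\mathbb{R}^{\sum_i n_i}$, $\boldsymbol\rho^*=(\rho_i^* )_i$, $\rho_i^*\in[0,\rho_i^J]$, such that for all $i\in\mathcal{N}$: $-w_{ii}g_i(\rho_i^* )-\sum_{l\in\mathcal{S}_i}w_{il}g_i(\rho_i^*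 )+\sum_{j\in\mathcal{P}_i}w_{ji}g_j(\rho_j^* )+u_i^*=0$, $x_{\rho_i}^*=k_i^u(-\rho_i^* )$, $u_i^*=k_i^{u,y}(-\rho_i^* )$. **Local input strict passivity.** The VAC dynamics of region $i$ are locally input strictly passive about the constant input value $\bar\rho_i\in(0,\rho_i^J)$ and the corresponding steady state $x_{\rho_i}^*\in\mathbb{R}^{n_i}$ if there exist open neighbourhoods $\mathcal{X}_i$ of $x_{\rho_i}^*$ and $\mathcal{U}_i$ of $-\bar\rho_i$ and a continuously differentiable storage function $V_i(x_{\rho_i})$ such that for all $-\rho_i\in\mathcal{U}_i$, $x_{\rho_i}\in\mathcal{X}_i$: $V_i>0$ on $\mathbb{R}^{n_i}\setminus\{x_{\rho_i}^*\}$, $V_i(x_{\rho_i}^* )=0$, and $$\dot V_i\le(-\rho_i-(-\bar\rho_i))(u_i-\bar u_i)-\theta_i(-\rho_i-(-\bar\rho_i)),$$ where $\dot V_i$ is the derivative along $\dot x_{\rho_i}=\chi_{\rho_i}(x_{\rho_i},-\rho_i)$, $u_i=y_{\rho_i}(x_{\rho_i},-\rho_i)$, $\bar u_i=y_{\rho_i}(x_{\rho_i}^*,-\bar\rho_i)$, and $\theta_i:\mathbb{R}\to\mathbb{R}_+$ is a positive definite function satisfying $\eta_i(\rho_i-\bar\rho_i)^2\le\theta_i(-\rho_i-(-\bar\rho_i))$ with a constant $\eta_i>0$. *)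

(* Defs.v *)
From HB Require Import structures.
From mathcomp Require Import all_boot all_order all_algebra.
From mathcomp Require Import all_classical all_reals all_analysis.
Set Implicit Arguments.
Unset Strict Implicit.
Unset Printing Implicit Defensive.
Import Order.TTheory GRing.Theory Num.Theory.
Import numFieldNormedType.Exports.
Local Open Scope classical_set_scope.
Local Open Scope ring_scope.

Section RealFunctions.
Variable R : realType.

Definition concave_on (A : set R) (f : R -> R) : Prop :=
  convex_function (A : set R^o) (fun x : R^o => - f x).

Definition unique_max_at (A : set R) (f : R -> R) (c : R) : Prop :=
  A c /\ forall x, A x -> x != c -> f x < f c.

Definition positive_definite (theta : R -> R) : Prop :=
  theta 0 = 0 /\ forall s, s != 0 -> 0 < theta s.

(* In finite dimension, continuity of x |-> 'd V x in operator norm is the same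
   as its pointwise continuity. *)
Definition continuously_differentiable (m : nat) (V : 'rV[R]_m -> R) : Prop :=
  (forall x, differentiable V x) /\
  forall v : 'rV[R]_m, continuous (fun x => 'd V x v : R).

End RealFunctions.

Section Dynamics.
Variables (R : realType) (S : normedModType R).
Implicit Types (F : S -> S) (D : set S) (T : \bar R) (z : R -> S).

(* Solutions of z' = F z on [0, T[, with T finite or +oo, staying in the state
   space D.  At t = 0 only continuity is required; when F is continuous on D,
   the right derivative at 0 then exists and is F (z 0). *)
Definition solution F D T z : Prop :=
  [/\ (0 < T)%E,
      forall t, 0 <= t -> (t%:E < T)%E -> D (z t),
      {within [set t | 0 <= t /\ (t%:E < T)%E], continuous z} &
      forall t, 0 < t -> (t%:E < T)%E -> is_derive t 1 z (F (z t))].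

Definition maximal_solution F D T z : Prop :=
  solution F D T z /\
  forall T' z', (T < T')%E -> solution F D T' z' ->
    ~ (forall t, 0 <= t -> (t%:E < T)%E -> z' t = z t).

(* Ranging over maximal solutions, rather than over those given on [0, +oo[,
   excludes finite escape times. *)
Definition locally_asymptotically_stable F D (p : S) : Prop :=
  (forall e, 0 < e -> exists2 d, 0 < d &
     forall T z, maximal_solution F D T z -> `|z 0 - p| < d ->
       T = +oo%E /\ forall t, 0 <= t -> `|z t - p| < e) /\
  (exists2 d, 0 < d &
     forall T z, maximal_solution F D T z -> `|z 0 - p| < d ->
       T = +oo%E /\ z t @[t --> +oo] --> p).

Definition converges_to_set z (A : set S) : Prop :=
  forall e, 0 < e -> \forall t \near +oo, exists2 a, A a & `|z t - a| < e.

End Dynamics.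

(* The functions [flow], [speed] and [unc] are meaningful on [0, jam i] only. *)
Record traffic_network (R : realType) (n : nat) := TrafficNetwork {
  edge : rel 'I_n ;               (* (i, j) is an edge *)
  weight : 'I_n -> 'I_n -> R ;    (* w_ij *)
  jam : 'I_n -> R ;               (* rho_i^J *)
  len : 'I_n -> R ;               (* L_i *)
  trip : 'I_n -> R ;              (* l_i *)
  flow : 'I_n -> R -> R ;         (* f_i *)
  speed : 'I_n -> R -> R ;        (* psi_i *)
  flow_lip : 'I_n -> R ;          (* v_i^L *)
  unc : 'I_n -> R -> R ;          (* d_i *)
  unc_lip : 'I_n -> R             (* v_i^{d,L} *)
}.

(* The pair argument of [chi] and [out] is (x_i, - rho_i), with second
   component in [- jam i, 0]. *)
Record vac_dynamics (R : realType) (n : nat) := VacDynamics {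
  dimx : 'I_n -> nat ;                                          (* n_i *)
  chi : forall i, 'rV[R]_(dimx i) * R -> 'rV[R]_(dimx i) ;
  out : forall i, 'rV[R]_(dimx i) * R -> R                      (* y_i *)
}.

Arguments chi {R n} v i _.
Arguments out {R n} v i _.

(* The states (x, rho) of the interconnection; [submxrow x i] is the VAC state
   of region i. *)
Notation state R n C := ('rV[R]_(\sum_(i < n) dimx C i) * 'rV[R]_n)%type.

Section Model.
Variables (R : realType) (n : nat).
Variables (N : traffic_network R n) (C : vac_dynamics R n).

Definition len_ratio (i : 'I_n) : R := len N i / trip N i.

Definition total_flow (i : 'I_n) (x : R) : R :=
  len_ratio i * flow N i x + unc N i x.

Definition dens (i : 'I_n) : set R := `[0, jam N i].

(* Weak connectivity: connectedness of the underlying undirected graph. *)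
Definition graph_connected : Prop :=
  forall i j, connect (fun a b => edge N a b || edge N b a) i j.

Definition flow_assumptions (i : 'I_n) : Prop :=
  [/\ forall x, dens i x -> 0 <= flow N i x,
      [bounded flow N i x | x in dens i],
      forall x, dens i x -> flow N i x = x * speed N i x,
      concave_on (dens i) (flow N i) /\
        (exists c, 0 < c < jam N i /\ unique_max_at (dens i) (flow N i) c) &
      (flow_lip N i).-lipschitz_(dens i) (flow N i)].

Definition unc_assumptions (i : 'I_n) : Prop :=
  [/\ [bounded unc N i x | x in dens i],
      0 <= unc_lip N i /\ (unc_lip N i).-lipschitz_(dens i) (unc N i),
      forall x, dens i x -> - (len_ratio i * flow N i x) <= unc N i x,
      concave_on (dens i) (total_flow i) &
      exists c, unique_max_at (dens i) (total_flow i) c].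

Definition network_assumptions : Prop :=
  [/\ graph_connected,
      forall i, [/\ 0 < jam N i, 0 < len N i & 0 < trip N i],
      forall i, [/\ 0 <= weight N i i,
        forall l, edge N i l -> 0 <= weight N i l &
        weight N i i + \sum_(l | edge N i l) weight N i l = 1],
      forall i, flow_assumptions i &
      forall i, unc_assumptions i].

Definition vac_domain (i : 'I_n) : set ('rV[R]_(dimx C i) * R) :=
  setT `*` `[- jam N i, 0].

Arguments vac_domain : clear implicits.

Definition vac_assumptions : Prop :=
  forall i,
  [/\ [locally [lipschitz chi C i p | p in vac_domain i]],
      {within vac_domain i, continuous (out C i)} &
      forall rho, dens i rho ->
        (exists! x, chi C i (x, - rho) = 0) /\
        (forall x, chi C i (x, - rho) = 0 ->
           locally_asymptotically_stable
             (fun x' => chi C i (x', - rho)) setT x)].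

(* The static characteristic maps k_i^u and k_i^{u,y}, as functions of the
   input s = - rho_i. *)
Definition static_state (i : 'I_n) (s : R) : 'rV[R]_(dimx C i) :=
  get [set x | chi C i (x, s) = 0].

Definition static_output (i : 'I_n) (s : R) : R :=
  out C i (static_state i s, s).

Definition net_inflow (rho : 'rV[R]_n) (u : R) (i : 'I_n) : R :=
  - weight N i i * total_flow i (rho 0 i)
  - \sum_(l | edge N i l) weight N i l * total_flow i (rho 0 i)
  + \sum_(j | edge N j i) weight N j i * total_flow j (rho 0 j)
  + u.

Definition state_space : set (state R n C) :=
  [set z : state R n C | forall i, dens i (z.2 0 i)].

Definition vector_field (z : state R n C) : state R n C :=
  (\mxrow_(i < n) chi C i (submxrow z.1 i, - z.2 0 i),
   \row_(i < n) ((len N i)^-1 *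
     net_inflow z.2 (out C i (submxrow z.1 i, - z.2 0 i)) i)).

Definition equilibria : set (state R n C) :=
  [set z : state R n C | forall i,
    [/\ dens i (z.2 0 i),
        net_inflow z.2 (static_output i (- z.2 0 i)) i = 0 &
        submxrow z.1 i = static_state i (- z.2 0 i)]].

(* [eta] is a quadratic growth constant of the supply-rate margin [theta]; the
   storage function is positive definite on the whole of 'rV_(dimx C i), while
   the dissipation inequality is local. *)
Definition input_strictly_passive (i : 'I_n) (xs : 'rV[R]_(dimx C i))
    (rs eta : R) : Prop :=
  0 < eta /\
  exists (X : set 'rV[R]_(dimx C i)) (U : set R)
         (V : 'rV[R]_(dimx C i) -> R) (theta : R -> R),
  [/\ [/\ open X, X xs, open U & U (- rs)],
      [/\ continuously_differentiable V, V xs = 0 &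
          forall x, x != xs -> 0 < V x],
      positive_definite theta,
      forall rho, dens i rho -> U (- rho) ->
        eta * (rho - rs) ^+ 2 <= theta (- rho - - rs) &
      forall rho x, dens i rho -> U (- rho) -> X x ->
        'd V x (chi C i (x, - rho)) <=
          (- rho - - rs) *
            (out C i (x, - rho) - out C i (xs, - rs))
          - theta (- rho - - rs)].

Definition coupling (j i : 'I_n) : R :=
  weight N j i * (len_ratio j * flow_lip N j + unc_lip N j).

End Model.

Arguments input_strictly_passive {R n} N C i xs rs eta.
Arguments state_space {R n} N C.
Arguments vector_field {R n} N C z.
Arguments equilibria {R n} N C.

(* Main.v *)
(* The sum of len_i / 2 (rho_i - rho_i^* )^2 and of the storage functions of the
   VAC dynamics is a strict Lyapunov function in the densities: the control
   inputs cancel against the supply rates, and by Young's inequality the gain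
   condition makes the coupling terms smaller than the passivity margins.  Sublevel
   sets near the equilibrium are therefore compact and positively invariant;
   solutions starting there cannot stop in finite time by Peano's theorem.  The
   latter is needed because the outputs y_i, hence the vector field, are only
   continuous.  On the omega-limit set the densities are frozen at rho^*, where the
   VAC states obey autonomous dynamics that converge to x^*.  LaSalle's argument then
   shows that the solution converges to the equilibrium itself, which is stronger
   than convergence to the set of equilibria. *)

(* Instead the time translates [z (k + t)] are passed to the limit along an ultrafilter in [k]:
   compactness gives a limit at every time, and an increment estimate uniform in [k] makes that
   limit a trajectory. The same limit lemma, applied to Euler iterates, gives Peano's theorem. Both
   uses need a form of derivative that survives pointwise limits, hence slopes stated as increment
   bounds, with the vector-valued mean value inequality in place of integration. Solutions live in
   the closed box of densities, whereas the field is known to be continuous only in its interior;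
   the Lyapunov argument is therefore confined to a ball inside it. *)
Require Import Defs.
From HB Require Import structures.
From mathcomp Require Import all_boot all_order all_algebra.
From mathcomp Require Import all_classical all_reals all_analysis.
From mathcomp Require Import ring lra.
Set Implicit Arguments.
Unset Strict Implicit.
Unset Printing Implicit Defensive.
Import Order.TTheory GRing.Theory Num.Theory.
Import numFieldNormedType.Exports.
Local Open Scope classical_set_scope.
Local Open Scope ring_scope.

(** * Relative derivatives and the mean value inequality *)

Section Slopes.
Variables (R : realType) (S : normedModType R).
Implicit Types (I : set R) (z : R -> S) (v : S).

(* [v] is the derivative of [z] at [s] relative to [I], one-sided if [s] is an
   end point of [I]; trajectories can thus be glued at end points. *)
Definition has_slope I z s v := forall e, 0 < e -> exists2 d, 0 < d &
  forall t, I t -> `|t - s| < d -> `|z t - z s - (t - s) *: v| <= e * `|t - s|.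

Lemma is_derive_slope z (s : R) v : is_derive s 1 z v <-> has_slope setT z s v.
Proof.
split=> [[dz <-] e e0|H].
  have /cvgrPdist_le/(_ _ e0) : h^-1 *: ((z \o shift s) (h *: (1 : R)) - z s)
      @[h --> 0^'] --> 'D_1 z s by [].
  rewrite near_withinE => /nbhs_normP[/= d d0 Hd].
  exists d => // t _ ts.
  have [->|ne] := eqVneq t s; first by rewrite !subrr scale0r subr0 !normr0 mulr0.
  have := Hd (t - s); rewrite /ball_ /= sub0r normrN subr_eq0 => /(_ ts ne) /=.
  rewrite [_ *: (1 : R)]mulr1 subrK => He.
  have -> : z t - z s - (t - s) *: 'D_1 z s
    = - (t - s) *: ('D_1 z s - (t - s)^-1 *: (z t - z s)).
    by rewrite scaleNr scalerBr scalerA divff ?subr_eq0// scale1r opprB.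
  by rewrite normrZ normrN mulrC ler_wpM2r.
suff cv : h^-1 *: ((z \o shift s) (h *: (1 : R)) - z s) @[h --> 0^'] --> v.
  by split; [exact: (cvgP _ cv)|exact: (cvg_lim _ cv)].
apply/cvgrPdist_le => e e0; have [d d0 Hd] := H _ e0.
rewrite near_withinE; apply/nbhs_normP; exists d => //= h.
rewrite /ball_ /= sub0r normrN => hd h0.
have := Hd (h + s) I; rewrite addrK => /(_ hd) He.
rewrite /= [_ *: (1 : R)]mulr1 -(@ler_pM2r _ `|h|) ?normr_gt0//.
rewrite (le_trans _ He)// mulrC -normrZ scalerBr scalerA divff// scale1r.
by rewrite distrC.
Qed.

Lemma has_slope_cvg I z s v e : has_slope I z s v -> 0 < e ->
  exists2 d, 0 < d & forall t, I t -> `|t - s| < d -> `|z t - z s| <= e.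
Proof.
move=> H e0; have [d d0 Hd] := H _ ltr01.
have p0 : 0 < 1 + `|v| by rewrite ltr_pwDl.
exists (Num.min d (e / (1 + `|v|))); first by rewrite lt_min d0 divr_gt0.
move=> t It; rewrite lt_min => /andP[/(Hd _ It) h]; rewrite ltr_pdivlMr// => h2.
rewrite -[_ - _](subrK ((t - s) *: v)) (le_trans (ler_normD _ _))//.
rewrite normrZ; nra.
Qed.

Lemma has_slope_sub I J z s v : J `<=` I -> has_slope I z s v ->
  has_slope J z s v.
Proof.
by move=> JI H e /H[d d0 Hd]; exists d => // t /JI; exact: Hd.
Qed.

(** Slopes are local: both the domain and the function may change away from [s], as happens when
    trajectories are glued. *)
Lemma has_slope_near I J z z' s v d : 0 < d -> z s = z' s ->
  (forall t, J t -> `|t - s| < d -> I t /\ z t = z' t) -> has_slope I z s v ->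
  has_slope J z' s v.
Proof.
move=> d0 zs JI H e /H[d' d'0 Hd]; exists (Num.min d d'); first by rewrite lt_min d0.
move=> t Jt; rewrite lt_min => /andP[/(JI _ Jt)[It zt] td'].
by rewrite -zt -zs; exact: Hd.
Qed.

Lemma has_slope_shift I z s v c : has_slope I z (s - c) v ->
  has_slope [set t | I (t - c)] (fun t => z (t - c)) s v.
Proof.
move=> H e /H[d d0 Hd]; exists d => // t /= It ts.
have tsE : t - c - (s - c) = t - s by rewrite opprB addrA subrK.
by have := Hd _ It; rewrite tsE; apply.
Qed.

Lemma has_slope_linearB I z s v w : has_slope I z s v ->
  has_slope I (fun t => z t - t *: w) s (v - w).
Proof.
move=> H e /H[d d0 Hd]; exists d => // t It ts.
have -> : z t - t *: w - (z s - s *: w) - (t - s) *: (v - w)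
  = z t - z s - (t - s) *: v.
  rewrite scalerBr [- (z s - _)]opprB [s *: w - _]addrC addrACA.
  rewrite [- (t *: w) + _]addrC -scalerBl -[s - t]opprB scaleNr opprB addrA.
  by rewrite subrK.
exact: Hd.
Qed.

Lemma dist_continuous (p : S) : continuous (fun x : S => `|x - p|).
Proof.
move=> x; apply: (cvg_comp (fun x => x - p) Num.norm); last exact: norm_continuous.
by apply: (@cvgB _ _ _ (nbhs x)); [exact: cvg_id|exact: cvg_cst].
Qed.

(** Continuity at the points of [K] is meant in the whole space, so that [y] may lie outside [K]. *)
Lemma compact_unif_continuous (S' : normedModType R) (F : S -> S') (K : set S) e :
  compact K -> (forall x, K x -> {for x, continuous F}) -> 0 < e ->
  exists2 d, 0 < d &
    forall x y, K x -> `|y - x| < d -> `|F y - F x| <= e.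
Proof.
move=> /compact_near_coveringP cK cF e0.
(* Compactness as near-covering, with the filter of radii tending to 0, yields one radius for all
   points of [K]. *)
have := cK _ (0 : R)^'+ (fun d x => forall y, `|y - x| < d -> `|F y - F x| <= e).
case.
  move=> x Kx; have e20 : 0 < e / 2 by rewrite divr_gt0.
  have /cvgrPdist_le/(_ _ e20)/nbhs_normP[/= d d0 Hd] := cF _ Kx.
  have d20 : 0 < d / 2 by rewrite divr_gt0.
  near=> x' r => y /= yx'.
  have hx : `|x - x'| < d / 2 by near: x'; apply/nbhs_normP; exists (d/2).
  have hr : r < d / 2 by near: r; exact: nbhs_right_lt.
  have h1 : `|x - y| < d.
    rewrite (splitr d) -(subrK x' x) -addrA (le_lt_trans (ler_normD _ _))//.
    by rewrite ltrD// distrC (lt_trans yx').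
  have h2 : `|x - x'| < d by lra.
  rewrite -(subrK (F x) (F y)) -addrA (le_trans (ler_normD _ _))// (splitr e).
  by rewrite lerD// ?Hd// distrC Hd.
move=> d /= d0 Hd; exists (d / 2); first by rewrite divr_gt0.
move=> x y Kx yx; apply: (Hd (d / 2)) => //=; last by rewrite divr_gt0.
by rewrite sub0r normrN gtr0_norm ?divr_gt0// ltr_pdivrMr// ltr_pMr// ltr1n.
Unshelve. all: end_near.
Qed.

End Slopes.

Section MeanValue.
Variables (R : realType) (S : normedModType R).
Implicit Types (z : R -> S).

(** Continuous induction: with the slack [e], the slope estimate extends the bound a little beyond
    any time where it holds. *)
Lemma slope_mean_value z (v : R -> S) a b M : a <= b ->
  (forall s, a <= s <= b -> has_slope `[a, b] z s (v s)) ->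
  (forall s, a <= s <= b -> `|v s| <= M) -> `|z b - z a| <= M * (b - a).
Proof.
move=> ab zv vM.
suff key e : 0 < e -> `|z b - z a| <= (M + e) * (b - a).
  have [->|ba] := eqVneq a b; first by rewrite !subrr normr0 mulr0.
  have ba0 : 0 < b - a by rewrite subr_gt0 lt_neqAle ba.
  apply/ler_addgt0Pr => e e0; have := key (e / (b - a)).
  by rewrite divr_gt0// mulrDl divfK ?gt_eqF// => /(_ isT).
move=> e0.
have near_slope s : a <= s <= b -> exists2 d, 0 < d & forall t, a <= t <= b ->
    `|t - s| < d -> `|z t - z s| <= (M + e) * `|t - s|.
  move=> sab; have [d d0 Hd] := zv _ sab _ e0; exists d => // t tab ts.
  have := Hd t; rewrite /= in_itv => /(_ tab ts) h.
  rewrite -[_ - _](subrK ((t - s) *: v s)) (le_trans (ler_normD _ _))//.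
  rewrite mulrDl addrC lerD// normrZ mulrC ler_wpM2r//; exact: vM.
(* [A] need not be an interval. Its supremum [c] lies in [A] by the slope estimate to the left of
   [c]; to the right, the estimate would give a larger element if [c < b]. *)
pose A := [set t | a <= t <= b /\ `|z t - z a| <= (M + e) * (t - a)].
have Aa : A a by rewrite /A /= lexx ab !subrr normr0 mulr0.
have ubA : ubound A b by move=> t [/andP[]].
have supA : has_sup A by split; [exists a|exists b].
set c := sup A.
have ac : a <= c by apply: ub_le_sup => //; case: supA.
have cb : c <= b by apply: ge_sup => //; exists a.
have cab : a <= c <= b by rewrite ac cb.
have [d d0 Hd] := near_slope _ cab.
have Ac : A c.
  have [t At] := sup_adherent d0 supA; rewrite -/c => ct.
  have tc : t <= c by apply: ub_le_sup => //; case: supA.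
  case: At => tab zt; split => //.
  have := Hd _ tab; rewrite distrC (distrC (z t)) ger0_norm ?subr_ge0// => Hdt.
  rewrite -(subrK (z t) (z c)) -addrA (le_trans (ler_normD _ _))//.
  have /Hdt : c - t < d by lra.
  rewrite distrC; nra.
have [cb'|] := ltP c b; last first.
  by move=> bc; case: Ac => _; rewrite (_ : c = b)//; apply/eqP; rewrite eq_le cb.
pose t := Num.min b (c + d / 2).
have ct : c < t by rewrite lt_min cb' ltrDl divr_gt0.
have tb : t <= b by rewrite ge_min lexx.
have tcd : t <= c + d / 2 by rewrite ge_min lexx orbT.
suff At : A t.
  by have := ub_le_sup (proj2 supA) At; rewrite leNgt ct.
have tab : a <= t <= b by rewrite tb (le_trans ac (ltW ct)).
split => //; case: Ac => _ zc.
have := Hd _ tab; rewrite ger0_norm ?subr_ge0 ?(ltW ct)// => Hdt.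
rewrite -(subrK (z c) (z t)) -addrA (le_trans (ler_normD _ _))//.
have /Hdt : t - c < d by lra.
nra.
Qed.

(** Subtracting the uniform motion [t *: w] reduces this to [slope_mean_value]. *)
Lemma slope_mean_value_near z (v : R -> S) a b w M : a <= b ->
  (forall s, a <= s <= b -> has_slope `[a, b] z s (v s)) ->
  (forall s, a <= s <= b -> `|v s - w| <= M) ->
  `|z b - z a - (b - a) *: w| <= M * (b - a).
Proof.
move=> ab zv vM.
have := @slope_mean_value (fun t => z t - t *: w) (fun s => v s - w) a b M ab.
move=> /(_ _ vM); rewrite scalerBl.
have -> : z b - b *: w - (z a - a *: w) = z b - z a - (b *: w - a *: w).
  by rewrite !opprB [a *: w - z a]addrC addrACA [- (b *: w) + _]addrC.
by apply => s /zv/has_slope_linearB.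
Qed.

End MeanValue.

(** * Trajectories of continuous vector fields *)

Section Solutions.
Variables (R : realType) (S : normedModType R).
Implicit Types (F : S -> S) (D K : set S) (T : \bar R) (z : R -> S).

Lemma compact_continuous_bound (S' : normedModType R) (F : S -> S') K :
  compact K -> (forall x, K x -> {for x, continuous F}) ->
  exists2 M, 0 < M & forall x, K x -> `|F x| <= M.
Proof.
move=> cK cF; have cFK : compact (F @` K).
  apply: continuous_compact => //.
  by apply: continuous_in_subspaceT => x; rewrite inE; exact: cF.
have /pinfty_ex_gt0[M M0 HM] := compact_bounded cFK.
by exists M => // x Kx; apply: HM; exists x.
Qed.

(** The base point [s] may lie on either side of [t], as two-sided slopes require. *)
Lemma slope_mean_value_sym z (v : R -> S) a b s t w M : a <= s <= b -> a <= t <= b ->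
  (forall u, a <= u <= b -> has_slope `[a, b] z u (v u)) ->
  (forall u, a <= u <= b -> `|u - s| <= `|t - s| -> `|v u - w| <= M) ->
  `|z t - z s - (t - s) *: w| <= M * `|t - s|.
Proof.
move=> /andP[as_ sb] /andP[at_ tb] zv vM.
have sub c d : a <= c -> d <= b -> forall u, c <= u <= d ->
    has_slope `[c, d] z u (v u).
  move=> ac db u /andP[cu ud]; apply: (has_slope_sub _ (zv u _)).
    by move=> x /=; rewrite !in_itv/= => /andP[cx xd];
       rewrite (le_trans ac)// (le_trans xd).
  by rewrite (le_trans ac)// (le_trans ud).
have [st|/ltW ts] := leP s t.
  rewrite ger0_norm ?subr_ge0//; apply: slope_mean_value_near => //.
    exact: sub.
  move=> u /andP[su ut]; apply: vM; first by rewrite (le_trans as_)// (le_trans ut).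
  by rewrite !ger0_norm ?subr_ge0// lerB.
rewrite distrC (distrC t) ger0_norm ?subr_ge0//.
have -> : (t - s) *: w - (z t - z s) = z s - z t - (s - t) *: w.
  by rewrite opprB addrC -[in RHS]scaleNr opprB.
apply: slope_mean_value_near => //; first exact: sub.
move=> u /andP[tu us]; apply: vM; first by rewrite (le_trans at_)// (le_trans us).
by rewrite !(distrC _ s) !ger0_norm ?subr_ge0// lerB.
Qed.

Lemma slope_lipschitz z (v : R -> S) a b s t M : a <= s <= b -> a <= t <= b ->
  (forall u, a <= u <= b -> has_slope `[a, b] z u (v u)) ->
  (forall u, a <= u <= b -> `|v u| <= M) ->
  `|z t - z s| <= M * `|t - s|.
Proof.
move=> sab tab zv vM.
have := @slope_mean_value_sym z v a b s t 0 M sab tab zv.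
by rewrite scaler0 subr0; apply => u uab _; rewrite subr0 vM.
Qed.

(** A trajectory in [K] has bounded speed, so [F] varies little along it over short times. That [d]
    depends only on [F], [K] and [e] is what allows a limit along time translates. *)
Lemma trajectory_modulus F K e : compact K ->
  (forall x, K x -> {for x, continuous F}) -> 0 < e ->
  exists2 d, 0 < d & forall z a b s t, a <= s <= b -> a <= t <= b ->
    (forall u, a <= u <= b -> K (z u) /\ has_slope `[a, b] z u (F (z u))) ->
    `|t - s| < d -> `|z t - z s - (t - s) *: F (z s)| <= e * `|t - s|.
Proof.
move=> cK cF e0; have [M M0 HM] := compact_continuous_bound cK cF.
have [d d0 Hd] := compact_unif_continuous cK cF e0.
exists (d / M); first by rewrite divr_gt0.
move=> z a b s t sab tab zK; rewrite ltr_pdivlMr// => ts.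
apply: (slope_mean_value_sym sab tab (v := F \o z)) => [u /zK[]//|u uab us].
apply: Hd; first by case: (zK _ sab).
rewrite (@le_lt_trans _ _ (M * `|u - s|))//.
  by apply: (slope_lipschitz sab uab (v := F \o z)) => [x /zK[]//|x /zK[/HM]].
by rewrite mulrC (le_lt_trans _ ts)// ler_wpM2r// ltW.
Qed.

Definition time_domain T : set R := [set t | 0 <= t /\ (t%:E < T)%E].

(** At time 0 a solution is only known to be continuous; there the estimate on [[a, t]] with [a > 0]
    passes to the limit as [a] tends to 0. *)
Lemma solution_slope F D T z s : solution F D T z -> {for z 0, continuous F} ->
  time_domain T s -> has_slope (time_domain T) z s (F (z s)).
Proof.
move=> [T0 _ /subspace_continuousP cz dz] cF [s0 sT].
have [s_gt0|] := ltP 0 s.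
  by apply: has_slope_sub (proj1 (is_derive_slope _ _ _) (dz _ s_gt0 sT)).
move=> s_le0; have {s0 s_le0 sT} -> : s = 0 by apply/eqP; rewrite eq_le s_le0.
have I0 : time_domain T 0 by split.
have cz0 e : 0 < e -> exists2 d, 0 < d & forall t, time_domain T t -> t < d ->
    `|z t - z 0| < e.
  move=> e0; have /cvgrPdist_lt/(_ _ e0) := cz _ I0.
  rewrite near_withinE => /nbhs_normP[d /= d0 Hd]; exists d => // t It td.
  rewrite distrC; apply: Hd => //=; rewrite /ball_/= sub0r normrN ger0_norm//.
  by case: It.
move=> e e0.
have /cvgrPdist_le/(_ _ e0)/nbhs_normP[/= d1 d10 Hd1] := cF.
have [d d0 Hd] := cz0 _ d10.
exists d => // t [t0 tT]; rewrite subr0 ger0_norm// => td.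
have [->|tn0] := eqVneq t 0; first by rewrite subrr scale0r subrr normr0 mulr0.
have {t0 tn0} t0 : 0 < t by rewrite lt_neqAle eq_sym tn0.
have sl a : 0 < a -> a <= t ->
    `|z t - z a - (t - a) *: F (z 0)| <= e * (t - a).
  move=> a0 at_; apply: (slope_mean_value_near (v := F \o z)) => // u /andP[au ut].
    have u0 := lt_le_trans a0 au.
    have uT : (u%:E < T)%E by rewrite (le_lt_trans _ tT)// lee_fin.
    by apply: has_slope_sub (proj1 (is_derive_slope _ _ _) (dz _ u0 uT)).
  rewrite distrC Hd1//= /ball_ /= distrC Hd//.
    by split; rewrite ?(ltW (lt_le_trans a0 au))// (le_lt_trans _ tT)// lee_fin.
  exact: le_lt_trans td.
apply/ler_addgt0Pr => h h0; have h20 : 0 < h / 2 by rewrite divr_gt0.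
have [d' d'0 Hd'] := cz0 _ h20.
have q0 : 0 < h / 2 / (1 + `|F (z 0)|) by rewrite divr_gt0// ltr_pwDl.
(* Small enough that starting at [a] instead of 0 costs at most [h / 2] in position and [h / 2] in
   the linear term. *)
pose a := Num.min t (Num.min (d' / 2) (h / 2 / (1 + `|F (z 0)|))).
have a0 : 0 < a by rewrite !lt_min t0 q0 andbT/= divr_gt0.
have at_ : a <= t by rewrite ge_min lexx.
have ad : a < d'.
  rewrite (@le_lt_trans _ _ (d' / 2))// ?ltr_pdivrMr ?ltr_pMr ?ltr1n//.
  by rewrite !ge_min lexx orbT.
have aq : a <= h / 2 / (1 + `|F (z 0)|) by rewrite !ge_min lexx !orbT.
have aF : a * `|F (z 0)| <= h / 2.
  move: aq; rewrite ler_pdivlMr ?ltr_pwDl//; nra.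
have za : `|z a - z 0| < h / 2.
  by apply: Hd' => //; split; rewrite ?ltW// (le_lt_trans _ tT)// lee_fin.
have -> : z t - z 0 - t *: F (z 0) =
    (z t - z a - (t - a) *: F (z 0)) + ((z a - z 0) - a *: F (z 0)).
  by rewrite addrACA -opprD -scalerDl subrK addrA subrK.
rewrite (le_trans (ler_normD _ _))//.
rewrite (le_trans (lerD (sl _ a0 at_) (ler_normB _ _)))// normrZ gtr0_norm//; nra.
Qed.

(** At a positive time the domain contains a two-sided neighbourhood, where the relative slope is
    the derivative. *)
Lemma slope_solution F D T z : (0 < T)%E ->
  (forall t, time_domain T t -> D (z t) /\ has_slope (time_domain T) z t (F (z t))) ->
  solution F D T z.
Proof.
move=> T0 H; split => //.
- by move=> t t0 tT; case: (H t).
- apply/subspace_continuousP => s Is; apply/cvgrPdist_le => e e0.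
  have [_ Hs] := H _ Is; have [d d0 Hd] := has_slope_cvg Hs e0.
  rewrite near_withinE; apply/nbhs_normP; exists d => // t /= st It.
  by rewrite distrC Hd// distrC.
- move=> t t0 tT; have It : time_domain T t by split => //; exact: ltW.
  have [_ Ht] := H _ It; apply/is_derive_slope.
  have [d d0 Hd] : exists2 d, 0 < d & forall u, `|u - t| < d -> (u%:E < T)%E.
    case: T T0 tT {H It Ht} => [T||] //= T0; last by exists 1 => // u _; rewrite ltry.
    rewrite lte_fin => tT; exists (T - t); first by rewrite subr_gt0.
    by move=> u; rewrite ltr_norml => /andP[_]; rewrite ltrD2r lte_fin.
  apply: (@has_slope_near _ _ _ _ _ _ _ _ (Num.min d t)) Ht => //.
    by rewrite lt_min d0.
  move=> u _; rewrite lt_min => /andP[/Hd uT]; rewrite ltr_norml => /andP[tu _].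
  by split => //; split => //; lra.
Qed.

End Solutions.

(** * Peano's existence theorem by Euler iterates *)

Section Peano.
Variables (R : realType) (S : normedModType R).
Implicit Types (F : S -> S) (K : set S).

Lemma ultra_fmap (T V : Type) (f : T -> V) (U : set_system T) :
  UltraFilter U -> UltraFilter (f @ U).
Proof.
move=> UU; split=> [|G GF fUG]; first exact: fmap_proper_filter.
rewrite predeqE => A; split=> [GA|]; last exact: fUG.
have [//|UnA] := in_ultra_setVsetC (f @^-1` A) UU.
have /filter_ex[? []//] : G (A `&` ~` A) by apply: filterI => //; exact: fUG.
Qed.

Lemma cvg_norm_le (T : Type) (U : set_system T) (f : T -> S) (l : S) B :
  ProperFilter U -> f @ U --> l -> (\forall k \near U, `|f k| <= B) -> `|l| <= B.
Proof.
move=> UF fl fB; apply/ler_addgt0Pr => e e0.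
have /cvgrPdist_le/(_ _ e0) lf := fl.
have [k [fk lk]] := filter_ex (filterI fB lf).
by rewrite -(subrK (f k) l) (le_trans (ler_normD _ _))// addrC lerD.
Qed.

(* An ultrafilter makes the approximate trajectories converge pointwise in [K],
   so that no equicontinuity argument is needed. *)
Lemma ultralimit_trajectory (T : Type) (U : set_system T) F K (I : set R)
    (w : T -> R -> S) : UltraFilter U -> compact K ->
  (forall x, K x -> {for x, continuous F}) ->
  (forall t, I t -> \forall k \near U, K (w k t)) ->
  (forall e, 0 < e -> exists2 d, 0 < d &
     forall s t, I s -> I t -> `|t - s| < d -> forall h, 0 < h ->
     \forall k \near U,
       `|w k t - w k s - (t - s) *: F (w k s)| <= e * `|t - s| + h) ->
  exists y : R -> S, forall t, I t ->
    [/\ K (y t), w k t @[k --> U] --> y t & has_slope I y t (F (y t))].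
Proof.
move=> UU cK cF wK wF.
have /choice[y Hy] t : exists p, I t -> K p /\ w k t @[k --> U] --> p.
  have [It|nIt] := pselect (I t); last by exists 0.
  have := cK; rewrite compact_ultra => /(_ _ (ultra_fmap (w ^~ t) UU) (wK _ It)).
  by move=> [p [Kp wp]]; exists p.
exists y => t It; have [Kt wt] := Hy _ It; split => // e /wF[d d0 Hd].
exists d => // s Is st; apply/ler_addgt0Pr => h h0.
have [Ks ws] := Hy _ Is.
apply: (cvg_norm_le _ _ (Hd _ _ It Is st _ h0)).
apply: cvgB; first exact: cvgB.
by apply: cvgZr; apply: (cvg_comp _ _ wt); exact: cF.
Qed.

Definition euler F (tau : R) (p : S) (j : nat) : S :=
  iter j (fun x => x + tau *: F x) p.

(** Each step deviates from [tau *: v] by at most [B * tau], and these errors add up. *)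
Lemma euler_increment F tau p v B j m : 0 <= tau ->
  (forall i, (j <= i < j + m)%N -> `|F (euler F tau p i) - v| <= B) ->
  `|euler F tau p (j + m) - euler F tau p j - (m%:R * tau) *: v|
    <= B * (m%:R * tau).
Proof.
move=> tau0; elim: m => [|m IH] H.
  by rewrite addn0 subrr mul0r scale0r subrr normr0 mulr0.
rewrite addnS /= -/(euler F tau p (j + m)).
set E := euler F tau p (j + m) in IH *; set E' := euler F tau p j in IH *.
have -> : E + tau *: F E - E' - (m.+1%:R * tau) *: v =
    (E - E' - (m%:R * tau) *: v) + tau *: (F E - v).
  rewrite -natr1 mulrDl mul1r scalerDl scalerBr opprD [E + _ - _]addrAC.
  by rewrite -!addrA; congr (_ + (_ + _)); rewrite addrCA.
rewrite (le_trans (ler_normD _ _))// -natr1 mulrDl mul1r mulrDr lerD//.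
  by apply: IH => i /andP[ji im]; rewrite H// ji addnS ltnW.
rewrite normrZ ger0_norm// mulrC ler_wpM2r// H//.
by rewrite leq_addr addnS ltnSn.
Qed.

(** A step from a point of the ball has length at most [tau * M]; the bound on the elapsed time
    keeps the iterates where [M] is valid. *)
Lemma euler_ball F tau p r M j : 0 <= tau ->
  (forall x, `|x - p| <= r -> `|F x| <= M) -> j%:R * tau * M <= r -> 0 <= M ->
  `|euler F tau p j - p| <= j%:R * tau * M.
Proof.
move=> tau0 HM + M0; elim: j => [|j IH]; first by rewrite subrr normr0 !mul0r.
rewrite -natr1 !mulrDl mul1r => jr.
have tM : 0 <= tau * M by rewrite mulr_ge0.
have jr' : j%:R * tau * M <= r by rewrite (le_trans _ jr)// lerDl.
rewrite /= -/(euler F tau p j) addrAC (le_trans (ler_normD _ _))// lerD ?IH//.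
by rewrite normrZ ger0_norm// ler_wpM2l// HM// (le_trans (IH jr')).
Qed.

(* The slope estimate for the Euler iterates holds both forwards and backwards in
   time, as required to differentiate their limit from both sides. *)
Lemma euler_slope F tau p r M d e j m : 0 <= tau -> 0 <= M -> 0 <= e ->
  (forall x, `|x - p| <= r -> `|F x| <= M) ->
  (forall x y, `|x - p| <= r -> `|y - x| < d -> `|F y - F x| <= e) ->
  j%:R * tau * M <= r -> m%:R * tau * M <= r ->
  `|m%:R - j%:R| * tau * M < d ->
  `|euler F tau p m - euler F tau p j
    - ((m%:R - j%:R) * tau) *: F (euler F tau p j)|
    <= e * (`|m%:R - j%:R| * tau).
Proof.
move=> tau0 M0 e0 HM Hd jr mr.
have tM : 0 <= tau * M by rewrite mulr_ge0.
have inb i n : (i <= n)%N -> n%:R * tau * M <= r -> `|euler F tau p i - p| <= r.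
  move=> ni nr; have ir : i%:R * tau * M <= r.
    by rewrite (le_trans _ nr)// -!mulrA ler_wpM2r// ler_nat.
  exact: le_trans (euler_ball tau0 HM ir M0) ir.
have lip i k : (i + k)%:R * tau * M <= r ->
    `|euler F tau p (i + k) - euler F tau p i| <= k%:R * tau * M.
  move=> nr; have := @euler_increment F tau p 0 M i k tau0.
  rewrite scaler0 subr0 mulrC; apply => n /andP[_ nk].
  by rewrite subr0 HM// (inb _ _ (ltnW nk)).
have [/subnKC jm|/ltnW/subnKC mj] := leqP j m.
  rewrite -{}jm in mr *; set k := (m - j)%N in mr *.
  rewrite natrD addrAC subrr add0r normr_nat => kd.
  apply: euler_increment => // i /andP[ji ik].
  apply: Hd; first by apply: (inb _ _ (leq_addr k j)).
  rewrite -(subnKC ji) (le_lt_trans (lip _ _ _))//.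
    by rewrite subnKC// (le_trans _ mr)// -!mulrA ler_wpM2r// ler_nat ltnW.
  rewrite (le_lt_trans _ kd)// -!mulrA ler_wpM2r// ler_nat.
  by rewrite leq_subLR ltnW.
rewrite -mj in jr *; set k := (j - m)%N in jr *.
rewrite natrD opprD addrA subrr add0r normrN normr_nat => kd.
rewrite mulNr scaleNr opprK -normrN opprD opprB.
apply: euler_increment => // i /andP[mi ik].
have ir : (i + (m + k - i))%:R * tau * M <= r by rewrite subnKC// ltnW.
apply: Hd; first by apply: (inb _ _ (leqnn _)).
rewrite distrC -[in X in `|X - _|](subnKC (ltnW ik)) (le_lt_trans (lip _ _ ir))//.
rewrite (le_lt_trans _ kd)// -!mulrA ler_wpM2r// ler_nat.
by rewrite leq_subLR leq_add2r.
Qed.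

Lemma peano F p r : 0 < r -> compact [set x | `|x - p| <= r] ->
  (forall x, `|x - p| <= r -> {for x, continuous F}) ->
  exists2 h, 0 < h & exists2 y : R -> S, y 0 = p &
    forall t, 0 <= t <= h ->
      `|y t - p| <= r /\ has_slope `[0, h] y t (F (y t)).
Proof.
move=> r0 cK cF.
have [M M0 HM] := compact_continuous_bound cK cF.
have Mn0 : M != 0 by rewrite gt_eqF.
(* At speed at most [M], leaving the ball takes at least the time [r / M]. *)
exists (r / M); first by rewrite divr_gt0.
set h := r / M; have h0 : 0 < h by rewrite divr_gt0.
pose tau k : R := h / k.+1%:R.
have tau0 k : 0 < tau k by rewrite divr_gt0.
have [U [UU ooU]] := @ultraFilterLemma nat \oo _.
pose idx k t := Num.trunc (t / tau k).
(* The approximations are step functions: their jumps vanish in the limit. *)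
pose w k t := euler F (tau k) p (idx k t).
have idxP k t : 0 <= t -> (idx k t)%:R * tau k <= t < (idx k t)%:R * tau k + tau k.
  move=> t0; have := truncn_itv (divr_ge0 t0 (ltW (tau0 k))).
  by rewrite -natr1 ler_pdivlMr// ltr_pdivrMr// mulrDl mul1r.
have idxM k t : 0 <= t <= h -> (idx k t)%:R * tau k * M <= r.
  move=> /andP[/(idxP k)/andP[it _] th]; rewrite -(divfK Mn0 r) ler_pM2r//.
  exact: le_trans it th.
have small c : 0 < c -> \forall k \near U, tau k < c.
  move=> c0; apply: ooU; have ch : 0 < c / h by rewrite divr_gt0.
  apply: filterS (near_infty_natSinv_lt (PosNum ch)) => k /=.
  by rewrite ltr_pdivlMr// mulrC.
have [| |y Hy] := @ultralimit_trajectory nat U F _ `[0, h] w UU cK cF.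
- move=> t; rewrite /= in_itv/= => th; near=> k.
  have hM := idxM k _ th.
  apply: (le_trans (euler_ball (ltW (tau0 k)) HM hM (ltW M0))) => //.
- move=> e e0; have [d d0 Hd] := compact_unif_continuous cK cF e0.
  (* Half of [d] is for the distance covered between [s] and [t], half for rounding these times to
     the grid. *)
  exists (d / (2 * M)); first by rewrite divr_gt0// mulr_gt0.
  move=> s t; rewrite /= !in_itv/= => sh th; rewrite ltr_pdivlMr ?mulr_gt0// => std b b0.
  near=> k.
  have td : tau k * (2 * M) < d.
    rewrite -ltr_pdivlMr ?mulr_gt0//; near: k; apply: small.
    by rewrite divr_gt0// mulr_gt0.
  (* Rounding costs [e * tau k] in the error bound and [M * tau k] in the linear term. *)
  have tb : tau k * (e + M) < b.
    rewrite -ltr_pdivlMr ?addr_gt0//; near: k; apply: small.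
    by rewrite divr_gt0// addr_gt0.
  have /andP[/(idxP k) /andP[s1 s2] _] := sh.
  have /andP[/(idxP k) /andP[t1 t2] _] := th.
  set j := idx k s in s1 s2; set m := idx k t in t1 t2.
  have dif : `|(m%:R - j%:R) * tau k - (t - s)| <= tau k.
    by rewrite ler_norml mulrBl; apply/andP; split; lra.
  have dif2 : `|m%:R - j%:R| * tau k <= `|t - s| + tau k.
    rewrite -{1}[tau k](ger0_norm (ltW (tau0 k))) -normrM.
    rewrite -[_ * tau k](subrK (t - s)).
    by rewrite (le_trans (ler_normD _ _))// addrC lerD2l.
  have kd : `|m%:R - j%:R| * tau k * M < d.
    rewrite (@le_lt_trans _ _ ((`|t - s| + tau k) * M))//.
      by rewrite ler_wpM2r// ltW.
    by lra.
  have := euler_slope (ltW (tau0 k)) (ltW M0) (ltW e0) HM Hd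
    (idxM k _ sh) (idxM k _ th) kd.
  rewrite -/j -/m /w -/j -/m => es.
  set Es := euler F (tau k) p j in es *; set Et := euler F (tau k) p m in es *.
  have FM : `|F Es| <= M.
    have hM := idxM k _ sh.
    by apply: (HM _); apply: (le_trans (euler_ball (ltW (tau0 k)) HM hM (ltW M0))).
  have -> : Et - Es - (t - s) *: F Es = (Et - Es - ((m%:R - j%:R) * tau k) *: F Es)
      + ((m%:R - j%:R) * tau k - (t - s)) *: F Es.
    by rewrite [in RHS]scalerBl addrA subrK.
  rewrite (le_trans (ler_normD _ _))// normrZ.
  have : `|(m%:R - j%:R) * tau k - (t - s)| * `|F Es| <= tau k * M by rewrite ler_pM.
  have : e * (`|m%:R - j%:R| * tau k) <= e * (`|t - s| + tau k) by rewrite ler_pM2l.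
  lra.
exists y => [|t th].
  have [|_ w0 _] := Hy 0; first by rewrite /= in_itv/= lexx ltW.
  have w00 : (fun k => w k 0) = cst p.
    by apply/funext => k; rewrite /w /idx mul0r truncn0.
  rewrite w00 in w0; apply: (@cvg_unique S (@norm_hausdorff _ _) _ _ _ _ w0).
  exact: cvg_cst.
by have [] := Hy t; rewrite /= ?in_itv.
Unshelve. all: end_near.
Qed.

End Peano.

(** * Extension of solutions confined to a compact set *)

Section Continuation.
Variables (R : realType) (S : normedModType R).
Implicit Types (F : S -> S) (D O K : set S) (T : \bar R) (z : R -> S).

(** Up to a finite [T] the solution is Lipschitz and confined to [K], so it has a limit in [K] at
    [T]; restarting there contradicts maximality. *)
Lemma maximal_solution_infinite F D O K T z :
  (forall p r, compact [set x : S | `|x - p| <= r]) ->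
  open O -> O `<=` D -> (forall x, O x -> {for x, continuous F}) ->
  compact K -> K `<=` O ->
  maximal_solution F D T z ->
  (forall t, time_domain T t -> K (z t)) -> T = +oo%E.
Proof.
move=> cB oO OD cF cK KO [solz maxz] zK.
case: T solz maxz zK => [T||//]; last by move=> [].
move=> solz maxz zK.
have T0 : 0 < T by case: solz; rewrite lte_fin.
have IE t : 0 <= t < T -> time_domain T%:E t.
  by move=> /andP[t0 tT]; split; rewrite ?lte_fin.
have cFK x : K x -> {for x, continuous F} by move=> /KO/cF.
have [M M0 HM] := compact_continuous_bound cK cFK.
have slz s : 0 <= s < T -> has_slope (time_domain T%:E) z s (F (z s)).
  by move=> /IE; apply: (solution_slope solz); apply/cFK/zK.
have slzab a b s : 0 <= a -> b < T -> a <= s <= b -> has_slope `[a, b] z s (F (z s)).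
  move=> a0 bT /andP[as_ sb]; apply: has_slope_sub (slz s _).
    move=> u; rewrite /= in_itv/= => /andP[au ub]; apply: IE.
    by rewrite (le_trans a0)// (le_lt_trans ub).
  by rewrite (le_trans a0)// (le_lt_trans sb).
have Kz s : 0 <= s < T -> K (z s) by move=> /IE/zK.
have lipz s t : 0 <= s < T -> 0 <= t < T -> `|z t - z s| <= M * `|t - s|.
  move=> /andP[s0 sT] /andP[t0 tT].
  have mT : Num.max s t < T by rewrite gt_max sT.
  apply: (@slope_lipschitz _ _ z (F \o z) 0 (Num.max s t)).
  - by rewrite s0 le_max lexx.
  - by rewrite t0 le_max lexx orbT.
  - by move=> u ust; apply: slzab.
  - move=> u /andP[u0 um]; apply/HM/Kz.
    by rewrite u0 (le_lt_trans um).
(* Compactness gives a limit [p] along [U]; the Lipschitz bound then shows that [z t] is within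
   [M * (T - t)] of [p]. *)
have [U [UU TU]] := ultraFilterLemma (at_left_proper_filter T).
have nearU t : 0 <= t < T -> \forall s \near U, t < s < T.
  move=> /andP[_ tT]; apply: TU; near=> s; apply/andP; split; near: s.
    exact: nbhs_left_gt.
  exact: nbhs_left_lt.
have := cK; rewrite compact_ultra => /(_ (z @ U) (ultra_fmap z UU)).
have I0 : 0 <= (0 : R) < T by rewrite lexx.
case.
  apply: filterS (nearU 0 I0) => s /andP[s0 sT]; apply: Kz; by rewrite ltW.
move=> p [Kp zp].
have lipp t : 0 <= t < T -> `|z t - p| <= M * (T - t).
  move=> tT; rewrite distrC; have cv : z s - z t @[s --> U] --> p - z t.
    by apply: cvgB => //; exact: cvg_cst.
  apply: (cvg_norm_le _ cv); apply: filterS (nearU t tT) => s /andP[ts sT].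
  have /andP[t0 _] := tT.
  rewrite (le_trans (lipz _ _ tT _))//; first by rewrite (le_trans t0 (ltW ts)).
  by rewrite ger0_norm ?subr_ge0 ?(ltW ts)// ler_pM2l// lerD2r ltW.
have /nbhs_normP[r1 /= r10 Hr1] : nbhs p O by apply: open_nbhs_nbhs; split => //; exact: KO.
have r0 : 0 < r1 / 2 by rewrite divr_gt0.
have ballO x : `|x - p| <= r1 / 2 -> O x.
  move=> xp; apply: Hr1; rewrite /ball_ /= distrC (le_lt_trans xp)//.
  by rewrite ltr_pdivrMr// ltr_pMr// ltr1n.
have [h h0 [y y0 Hy]] := @peano R S F p (r1 / 2) r0 (cB _ _) (fun x Hx => cF _ (ballO x Hx)).
(* Continue [z] beyond [T] by a local solution starting at its end point [p]. *)
pose z' t := if t < T then z t else y (t - T).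
apply: False_ind; apply: (maxz (T + h)%:E z').
- by rewrite lte_fin ltrDl.
- apply: slope_solution; first by rewrite lte_fin addr_gt0.
  move=> t [t0]; rewrite lte_fin => tTh.
  have [tT|tT|tT] := ltgtP t T.
  + rewrite /z' tT; split.
      by apply: OD; apply/KO/Kz; rewrite t0.
    apply: (@has_slope_near _ _ (time_domain T%:E) _ z _ _ _ (T - t)) => //.
    * by rewrite subr_gt0.
    * by rewrite tT.
    * move=> u [u0 _]; rewrite ltr_norml => /andP[_]; rewrite ltrD2r => uT.
      by rewrite uT; split => //; apply: IE; rewrite u0.
    * by apply: slz; rewrite t0.
  + have z't : z' t = y (t - T) by rewrite /z' ltNge (ltW tT).
    rewrite z't; have tTh' : 0 <= t - T <= h by lra.
    have [yt sy] := Hy _ tTh'; split; first exact/OD/ballO.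
    apply: (has_slope_near _ _ _ (has_slope_shift sy) (d := t - T)) => //.
    * by rewrite subr_gt0.
    * move=> u /= [u0]; rewrite lte_fin => uTh; rewrite ltr_norml => /andP[ut _].
      rewrite /z' in_itv/=; split; first by apply/andP; split; lra.
      by rewrite ltNge (_ : T <= u)//; lra.
  (* At the junction both one-sided slopes are [F p]: on the right by the choice of [y], on the left
     by the mean value inequality on [[t, s]] as [s] tends to [T] along [U]. *)
  + rewrite {t t0 tTh}tT; have z'T : z' T = p by rewrite /z' ltxx subrr y0.
    rewrite z'T; split; first exact/OD/KO.
    move=> e e0.
    have /Hy[_] : 0 <= (0 : R) <= h by rewrite lexx ltW.
    move=> /(_ _ e0)[d d0]; rewrite y0 => Hd.
    have /cvgrPdist_le/(_ _ e0)/nbhs_normP[/= d1 d10 Hd1] := cFK _ Kp.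
    exists (Num.min d (Num.min h (d1 / M))).
      by rewrite !lt_min d0 h0 divr_gt0.
    move=> t [t0 _]; rewrite !lt_min => /and3P[td th]; rewrite ltr_pdivlMr// => tM.
    rewrite z'T /z'; have [tT|Tt] := ltP t T; last first.
      have := Hd (t - T); rewrite subr0; apply => //.
      by rewrite /= in_itv/= subr_ge0 Tt -(ger0_norm (_ : 0 <= t - T)) ?subr_ge0// ltW.
    have tI : 0 <= t < T by rewrite t0.
    rewrite (_ : z t - p - _ = - (p - z t - (T - t) *: F p)); last first.
      by rewrite -[t - T]opprB scaleNr opprK [RHS]opprB [- (p - z t)]opprB addrC.
    have cv : z s - z t - (s - t) *: F p @[s --> U] --> p - z t - (T - t) *: F p.
      apply: cvgB; first by apply: cvgB => //; exact: cvg_cst.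
      apply: cvgZl; apply: cvgB; last exact: cvg_cst.
      by apply: (cvg_trans TU); apply: cvg_at_left_filter; exact: cvg_id.
    rewrite normrN; apply: (cvg_norm_le _ cv).
    apply: filterS (nearU _ tI) => s /andP[ts sT].
    rewrite (@le_trans _ _ (e * (s - t)))//; last first.
      by rewrite ler_pM2l// ltr0_norm ?subr_lt0// opprB lerD2r ltW.
    apply: (slope_mean_value_near (v := F \o z)); first exact: ltW.
      by move=> u; apply: slzab.
    move=> u /andP[tu us].
    have uI : 0 <= u < T by rewrite (le_trans t0)// (le_lt_trans us).
    rewrite distrC Hd1//= /ball_ /= distrC (le_lt_trans (lipp _ uI))//.
    rewrite mulrC (le_lt_trans _ tM)// ler_pM2r// ltr0_norm ?subr_lt0// opprB.
    by rewrite lerB.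
- by move=> t t0; rewrite lte_fin /z' => ->.
Unshelve. all: by end_near.
Qed.

End Continuation.

(** * Barbashin-Krasovskii-LaSalle *)

Section LaSalle.
Variables (R : realType) (S : normedModType R).
Implicit Types (F : S -> S) (D O K : set S) (T : \bar R) (z : R -> S).

(** [W] attains its minimum on the shell, which avoids [e] as [a > 0]. This provides the level that
    confines solutions, and later turns convergence of [W] to 0 into convergence to [e]. *)
Lemma positive_on_shell (W : S -> R) (e : S) a r :
  compact [set x : S | `|x - e| <= r] -> continuous W ->
  (forall x, x != e -> 0 < W x) -> 0 < a ->
  exists2 m, 0 < m & forall x, a <= `|x - e| <= r -> m <= W x.
Proof.
move=> cB cW Wpos a0; pose A := [set x : S | a <= `|x - e| <= r].
have cA : compact A.
  rewrite (_ : A = [set x : S | `|x - e| <= r]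
      `&` (fun x => `|x - e|) @^-1` [set y | a <= y]).
    apply: compact_closedI => //; apply: closed_comp; last exact: closed_ge.
    by move=> x _; exact: dist_continuous.
  by apply/seteqP; split => x /=; [move=> /andP[]|move=> [xr ax]; apply/andP].
have [A0|A0] := pselect (A !=set0); last first.
  by exists 1 => // x xA; exfalso; apply: A0; exists x.
have [c cin cmin] := compact_EVT_min A0 cA (continuous_subspaceT cW).
exists (W c).
  apply: Wpos; move: cin; rewrite inE => /andP[ac _].
  by apply: contraTneq ac => ->; rewrite subrr normr0 -ltNge.
by move=> x xA; apply: cmin; rewrite inE.
Qed.

(** By the mean value theorem, derivatives matter at interior times only; time 0, where a solution
    is merely continuous, may thus be an end point. *)
Lemma lyapunov_nincr F D T z (W : S -> R) (P : set S) s t :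
  solution F D T z -> continuous W ->
  (forall u, P (z u) -> is_derive u 1 z (F (z u)) ->
     exists2 w, is_derive u 1 (W \o z) w & w <= 0) ->
  0 <= s -> s <= t -> (t%:E < T)%E -> (forall u, s < u < t -> P (z u)) ->
  W (z t) <= W (z s).
Proof.
move=> [_ _ cz dz] cW dW s0; rewrite le_eqVlt => /predU1P[->//|st] tT Pz.
have dWz u : u \in `]s, t[ -> is_derive u 1 (W \o z) ('D_1 (W \o z) u) /\
    'D_1 (W \o z) u <= 0.
  rewrite in_itv/= => /andP[su ut].
  have [||w dw w0] := dW u.
  - by apply: Pz; rewrite su.
  - apply: dz; first exact: le_lt_trans su.
    by rewrite (lt_trans _ tT)// lte_fin.
  by rewrite (derive_val (is_derive := dw)).
have cWz : {within `[s, t], continuous (W \o z)}.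
  apply/subspace_continuousP => u ust; apply: (cvg_comp z W); last exact: cW.
  have : {within `[s, t], continuous z}.
    apply: continuous_subspaceW cz => v; rewrite /= in_itv/= => /andP[sv vt].
    by rewrite (le_trans s0)// (le_lt_trans _ tT)// lee_fin.
  by move=> /subspace_continuousP; exact.
have [c cst] := MVT st (fun u ust => (dWz u ust).1) cWz.
move=> /= E; rewrite -subr_le0 E; apply: mulr_le0_ge0; first exact: (dWz c cst).2.
by rewrite subr_ge0 ltW.
Qed.

(** At a first exit through the sphere of radius [r], [W] would be at least [m], although it has not
    increased from [W (z 0) < m]. *)
Lemma lyapunov_stable F D T z (W : S -> R) (e : S) r m :
  solution F D T z -> continuous W ->
  (forall u, `|z u - e| <= r -> is_derive u 1 z (F (z u)) ->
     exists2 w, is_derive u 1 (W \o z) w & w <= 0) ->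
  (forall x, `|x - e| = r -> m <= W x) ->
  `|z 0 - e| < r -> W (z 0) < m ->
  forall t, time_domain T t -> `|z t - e| < r.
Proof.
move=> solz cW dW Wm z0r Wz0 t1 [t10 t1T]; rewrite ltNge; apply/negP => zt1.
have tdom s : 0 <= s <= t1 -> time_domain T s.
  by move=> /andP[? st]; split => //; rewrite (le_lt_trans _ t1T)// lee_fin.
have cz s h : 0 <= s <= t1 -> 0 < h -> exists2 d, 0 < d & forall t, 0 <= t <= t1 ->
    `|t - s| < d -> `|z t - z s| <= h.
  move=> /tdom sI h0; case: solz => _ _ /subspace_continuousP /(_ _ sI) + _.
  move=> /cvgrPdist_le/(_ _ h0); rewrite near_withinE => /nbhs_normP[d d0 Hd].
  exists d => // t tt1 ts; rewrite distrC; apply: Hd; last exact: tdom.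
  by rewrite /ball_ /= distrC.
pose A := [set t | 0 <= t <= t1 /\ r <= `|z t - e|].
have At1 : A t1 by split => //; rewrite t10 lexx.
have lbA : lbound A 0 by move=> t [/andP[]].
have infA : has_inf A by split; [exists t1|exists 0].
(* The first exit time; continuity from the right and from the left puts [z c] exactly on the
   sphere. *)
set c := inf A.
have c0 : 0 <= c by apply: lb_le_inf => //; case: infA.
have ct1 : c <= t1 by apply: ge_inf => //; case: infA.
have cI : 0 <= c <= t1 by rewrite c0.
have before u : 0 <= u -> u < c -> `|z u - e| < r.
  move=> u0 uc; rewrite ltNge; apply/negP => ru.
  have Au : A u by split => //; rewrite u0 (le_trans (ltW uc)).
  by have := ge_inf (proj2 infA) Au; rewrite leNgt uc.
have zc1 : r <= `|z c - e|.
  apply/ler_addgt0Pr => h h0; have [d d0 Hd] := cz _ _ cI h0.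
  have [t [tI rt]] := inf_adherent d0 infA; rewrite -/c => tcd.
  have ct : c <= t by apply: ge_inf => //; case: infA.
  have := Hd t tI; rewrite ger0_norm ?subr_ge0// ltrBlDl => /(_ tcd) tc.
  rewrite (le_trans rt)// -(subrK (z c) (z t)) -addrA (le_trans (ler_normD _ _))//.
  by rewrite [leRHS]addrC lerD2r.
have c_gt0 : 0 < c.
  by rewrite lt_neqAle c0 andbT; apply: contraTneq zc1 => <-; rewrite -ltNge.
have zc2 : `|z c - e| <= r.
  apply/ler_addgt0Pr => h h0; have [d d0 Hd] := cz _ _ cI h0.
  pose u := Num.max 0 (c - d / 2).
  have u0 : 0 <= u by rewrite le_max lexx.
  have uc : u < c by rewrite gt_max c_gt0/= gtrBl divr_gt0.
  have ud : c - d / 2 <= u by rewrite le_max lexx orbT.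
  have uI : 0 <= u <= t1 by rewrite u0 (le_trans (ltW uc)).
  have /(Hd _ uI) zuc : `|u - c| < d by rewrite ltr0_norm ?subr_lt0//; lra.
  rewrite -(subrK (z u) (z c)) -addrA (le_trans (ler_normD _ _))// [leRHS]addrC.
  by rewrite lerD//; [rewrite distrC|exact/ltW/before].
have := Wm (z c) (le_anti (introT andP (conj zc2 zc1))).
rewrite leNgt => /negP; apply; apply: le_lt_trans Wz0.
have cT : (c%:E < T)%E by case: (tdom _ cI).
apply: (@lyapunov_nincr F D T z W [set x | `|x - e| <= r]) => //.
by move=> u /andP[u0 uc]; exact/ltW/before/uc/ltW.
Qed.

(* Along a complete trajectory in the omega-limit set of a solution, [W] is
   constant and hence [Q] vanishes; if all such trajectories tend to [e], then
   that constant is [W e = 0], so that the solution itself tends to [e]. *)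
Lemma lasalle F D O (W Q : S -> R) (e : S) r :
  (forall p r, compact [set x : S | `|x - p| <= r]) ->
  open O -> O `<=` D -> (forall x, O x -> {for x, continuous F}) ->
  0 < r -> [set x | `|x - e| <= r] `<=` O ->
  continuous W -> W e = 0 -> (forall x, x != e -> 0 < W x) ->
  (forall x, `|x - e| <= r -> 0 <= Q x) ->
  (forall z t, `|z t - e| <= r -> is_derive t 1 z (F (z t)) ->
     exists2 w, is_derive t 1 (W \o z) w & w <= - Q (z t)) ->
  (forall z, (forall t, [/\ `|z t - e| <= r, Q (z t) = 0 &
                          is_derive t 1 z (F (z t))]) ->
     z t @[t --> +oo] --> e) ->
  exists M : set S, [/\ open M, M e &
    forall T z, maximal_solution F D T z -> M (z 0) ->
      T = +oo%E /\ z t @[t --> +oo] --> e].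
Proof.
move=> cB oO OD cF r0 BO cW We Wpos Q0 dW inv.
have cFB x : `|x - e| <= r -> {for x, continuous F} by move=> /BO/cF.
(* A lower bound of [W] on the sphere: solutions starting inside the ball below this level cannot
   leave it. *)
have [m m0 Hm] := positive_on_shell (cB e r) cW Wpos r0.
exists ([set x | `|x - e| < r] `&` [set x | W x < m]); split.
- apply: openI.
    apply: (@open_comp _ _ (fun x : S => `|x - e|) [set y | y < r]).
      by move=> x _; exact: dist_continuous.
    exact: open_lt.
  by apply: (@open_comp _ _ W [set y | y < m]) => [x _|]; [exact: cW|exact: open_lt].
- by rewrite /= subrr normr0 We.
move=> T z maxz [z0r z0m].
have dW' (u : R -> S) t : `|u t - e| <= r -> is_derive t 1 u (F (u t)) ->
    exists2 w, is_derive t 1 (W \o u) w & w <= 0.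
  move=> ur du; have [w dw wQ] := dW _ _ ur du; exists w => //.
  by rewrite (le_trans wQ)// oppr_le0 Q0.
have Hr x : `|x - e| = r -> m <= W x by move=> xr; rewrite Hm// xr lexx.
have zr := lyapunov_stable maxz.1 cW (dW' z) Hr z0r z0m.
have TE : T = +oo%E.
  apply: (maximal_solution_infinite cB oO OD cF (cB e r) BO maxz) => t /zr/ltW//.
split => //; move: maxz.1 zr; rewrite {}TE => solz zr {maxz}.
have zr' t : 0 <= t -> `|z t - e| <= r by move=> t0; apply/ltW/zr; split; rewrite ?ltry.
have Wdec s t : 0 <= s -> s <= t -> W (z t) <= W (z s).
  move=> s0 st; apply: (@lyapunov_nincr F D +oo%E z W [set x | `|x - e| <= r]) => //.
  - by move=> u; exact: dW'.
  - by rewrite ltry.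
  - by move=> u /andP[su _]; apply: zr'; rewrite (le_trans s0 (ltW su)).
have Wge0 x : 0 <= W x by have [->|/Wpos/ltW//] := eqVneq x e; rewrite We.
pose A := [set W (z t) | t in [set t | 0 <= t]].
have infA : has_inf A.
  split; first by exists (W (z 0)); exists 0 => //=.
  by exists 0 => _ [t _ <-].
set c := inf A.
have Wc : W (z t) @[t --> +oo] --> c.
  apply/cvgrPdist_le => h h0.
  have [_ [s /= s0 <-]] := inf_adherent h0 infA; rewrite -/c => sc.
  exists s; split; first exact: num_real.
  move=> t st; have t0 := le_trans s0 (ltW st).
  have ct : c <= W (z t) by apply: (ge_inf (proj2 infA)); exists t.
  rewrite distrC ger0_norm ?subr_ge0// lerBlDl.
  by rewrite (le_trans _ (ltW sc))// Wdec// ltW.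
have slz (s : R) : 0 <= s -> has_slope (time_domain +oo%E) z s (F (z s)).
  move=> s0; apply: (solution_slope solz); last by split; rewrite ?ltry.
  by apply: cFB; exact: zr'.
have [U [UU ooU]] := ultraFilterLemma (@proper_pinfty_nbhs R).
have largeU (b : R) : \forall k \near U, b < k.
  by apply: (ooU [set k | b < k]); exact: nbhs_pinfty_gt (num_real b).
have shiftoo (t : R) : (k + t) @[k --> U] --> +oo.
  by apply: cvg_trans (cvg_addrr t); exact: cvg_app.
(* [y] is a complete trajectory in the omega-limit set of [z]. *)
have [| |y Hy] := @ultralimit_trajectory R S R U F _ setT
  (fun k t => z (k + t)) UU (cB e r) cFB.
- move=> t _; apply: filterS (largeU (- t)) => k tk /=.
  by apply: zr'; lra.
- move=> h h0; have [d d0 Hd] := trajectory_modulus (cB e r) cFB h0.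
  exists d => // s t _ _ st b b0; near=> k.
  (* For such [k] both translated times are non-negative, and the uniform modulus applies on the
     interval between them. *)
  have kst : 0 <= k + Num.min s t.
    by rewrite -lerBlDr sub0r ltW//; near: k; exact: largeU.
  have := Hd z (k + Num.min s t) (k + Num.max s t) (k + s) (k + t).
  rewrite opprD addrACA subrr add0r => Hk.
  apply: le_trans (Hk _ _ _ st) _; last by rewrite lerDl ltW.
  + by rewrite !lerD2l ge_min le_max lexx.
  + by rewrite !lerD2l ge_min le_max lexx !orbT.
  + move=> u /andP[ku _]; have u0 := le_trans kst ku; split; first exact: zr'.
    apply: has_slope_sub (slz _ u0) => v; rewrite /= in_itv/= => /andP[kv _].
    by split; rewrite ?ltry// (le_trans kst).
have Wy t : W (y t) = c.
  have [_ yt _] := Hy t I.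
  have cv1 : W (z (k + t)) @[k --> U] --> W (y t).
    by apply: (cvg_comp (fun k => z (k + t)) W yt); exact: cW.
  have cv2 : W (z (k + t)) @[k --> U] --> c.
    by apply: (cvg_comp (fun k => k + t) (W \o z) (shiftoo t)); exact: Wc.
  exact: (@cvg_unique R (@norm_hausdorff _ _) _ _ _ _ cv1 cv2).
have dy (t : R) : is_derive t 1 y (F (y t)) by apply/is_derive_slope; have [] := Hy t I.
have yr t : `|y t - e| <= r by have [] := Hy t I.
have Qy (t : R) : Q (y t) = 0.
  have [w dw wQ] := dW _ _ (yr t) (dy t).
  have Wyc : W \o y = cst c by apply/funext => u /=; exact: Wy.
  rewrite Wyc in dw; have w0 : w = 0.
    by rewrite -(derive_val (is_derive := dw)) derive_cst.
  by apply/eqP; rewrite eq_le Q0// andbT -oppr_ge0 -w0.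
have cy := inv y (fun t => And3 (yr t) (Qy t) (dy t)).
have c0 : c = 0.
  have cv1 : W (y t) @[t --> +oo] --> 0.
    by rewrite -We; apply: (cvg_comp y W cy); exact: cW.
  have Wyc : (fun t => W (y t)) = cst c by apply/funext => u /=; exact: Wy.
  rewrite Wyc in cv1.
  exact: (@cvg_unique R (@norm_hausdorff _ _) _ _ _ _ (cvg_cst _) cv1).
rewrite c0 in Wc.
apply/cvgrPdist_lt => h h0.
(* Once [W (z t) < k], the state cannot lie in the shell between the radii [h] and [r]. *)
have [k k0 Hk] := positive_on_shell (cB e r) cW Wpos h0.
have /cvgrPdist_lt/(_ _ k0) := Wc.
near_simpl => Hc; near=> t.
rewrite distrC ltNge; apply/negP => ht.
have t0 : 0 <= t by near: t; exact: nbhs_pinfty_ge.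
have Wk : `|0 - W (z t)| < k by near: t.
have := Hk (z t); rewrite ht zr'// => /(_ isT).
by rewrite leNgt => /negP; apply; rewrite sub0r normrN ger0_norm in Wk.
Unshelve. all: by end_near.
Qed.

End LaSalle.

(** * The traffic network *)

Section Coordinates.
Variable R : realType.

Lemma row_norm_coord m (x : 'rV[R]_m) j : `|x 0 j| <= `|x|.
Proof.
rewrite [leRHS]/Num.norm /= mx_normrE.
exact: (le_bigmax _ (fun ij : 'I_1 * 'I_m => `|x ij.1 ij.2|) (0, j)).
Qed.

Lemma row_norm_le m (x : 'rV[R]_m) r : 0 <= r -> (forall j, `|x 0 j| <= r) ->
  `|x| <= r.
Proof.
move=> r0 xr; rewrite [leLHS]/Num.norm /= mx_normrE; apply: bigmax_le => //.
by move=> [i j] _ /=; rewrite (ord1 i).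
Qed.

Lemma row_compact_ball m (p : 'rV[R]_m) r : compact [set x | `|x - p| <= r].
Proof.
apply: bounded_closed_compact.
  exists (r + `|p|); split; first exact: num_real.
  move=> b rb x /= xr; rewrite -(subrK p x) (le_trans (ler_normD _ _))//.
  by rewrite (le_trans _ (ltW rb))// lerD2r.
apply: (@closed_comp _ _ (fun x : 'rV[R]_m => `|x - p|) [set y | y <= r]);
  last exact: closed_le.
by move=> x _; exact: dist_continuous.
Qed.

Lemma pair_compact_ball (U V : normedModType R) :
  (forall (p : U) r, compact [set x | `|x - p| <= r]) ->
  (forall (p : V) r, compact [set x | `|x - p| <= r]) ->
  forall (p : U * V) r, compact [set x | `|x - p| <= r].
Proof.
move=> cU cV p r.
rewrite (_ : mkset _ = [set x | `|x - p.1| <= r] `*` [set x | `|x - p.2| <= r]).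
  exact: compact_setX.
by apply/seteqP; split => x /=; rewrite prod_normE ge_max; [move/andP|move=> ?; apply/andP].
Qed.

Variables (n : nat) (d : 'I_n -> nat).

Lemma submxrow_norm (x : 'rV[R]_(\sum_i d i)) i : `|submxrow x i| <= `|x|.
Proof.
by apply: row_norm_le => // j; rewrite mxE; exact: row_norm_coord.
Qed.

Lemma mxrow_norm_le (B : forall i, 'rV[R]_(d i)) r : 0 <= r ->
  (forall i, `|B i| <= r) -> `|\mxrow_i B i| <= r.
Proof.
move=> r0 Br; apply: row_norm_le => // j; rewrite mxE.
exact: le_trans (row_norm_coord _ _) _.
Qed.

Section Cvg.
Variables (T : Type) (U : set_system T).
Context {FU : Filter U}.

Lemma cvg_mxrow (f : forall i, T -> 'rV[R]_(d i)) (l : forall i, 'rV[R]_(d i)) :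
  (forall i, f i t @[t --> U] --> l i) ->
  \mxrow_i f i t @[t --> U] --> \mxrow_i l i.
Proof.
move=> fl; apply/cvgrPdist_le => e e0.
have : \forall t \near U, forall i, `|l i - f i t| <= e.
  by apply: filter_forall => i; exact: cvgr_dist_le (fl i) _ e0.
by apply: filterS => t H; rewrite -mxrowB; apply: mxrow_norm_le; rewrite ?ltW.
Qed.

Lemma cvg_row m (f : 'I_m -> T -> R) (l : 'I_m -> R) :
  (forall i, f i t @[t --> U] --> l i) ->
  \row_i f i t @[t --> U] --> \row_i l i.
Proof.
move=> fl; apply/cvgrPdist_le => e e0.
have : \forall t \near U, forall i, `|l i - f i t| <= e.
  by apply: filter_forall => i; exact: cvgr_dist_le (fl i) _ e0.
by apply: filterS => t H; apply: row_norm_le => [|j]; [exact: ltW|rewrite !mxE].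
Qed.

Lemma cvg_sum (I : Type) (r : seq I) (P : pred I) (f : I -> T -> R) (l : I -> R) :
  (forall i, P i -> f i t @[t --> U] --> l i) ->
  \sum_(i <- r | P i) f i t @[t --> U] --> \sum_(i <- r | P i) l i.
Proof. by move=> fl; apply: cvg_big => //; exact: add_continuous. Qed.

End Cvg.

Lemma cvg_to_pair (T : Type) (F : set_system T) (U V : topologicalType)
    (f : T -> U) (g : T -> V) (u : U) (v : V) : Filter F ->
  f @ F --> u -> g @ F --> v -> (fun t => (f t, g t)) @ F --> (u, v).
Proof. by move=> FF fu gv; apply: cvg_pair. Qed.

Lemma continuous_pair (T U V : topologicalType) (f : T -> U) (g : T -> V) x :
  {for x, continuous f} -> {for x, continuous g} ->
  {for x, continuous (fun y => (f y, g y))}.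
Proof. exact: cvg_to_pair. Qed.

(** Meant for the projections onto one density or one VAC state: they do not increase norms, so
    increment bounds pass through them. *)
Lemma is_derive_linear_comp (S S' : normedModType R) (f : S -> S') z (t : R) v :
  (forall x y, f (x - y) = f x - f y) -> (forall a x, f (a *: x) = a *: f x) ->
  (forall x, `|f x| <= `|x|) -> is_derive t 1 z v -> is_derive t 1 (f \o z) (f v).
Proof.
move=> fB fZ fle /is_derive_slope H; apply/is_derive_slope => e e0.
have [dl d0 Hd] := H e e0.
by exists dl => // s _ st; rewrite /= -fB -fZ -fB (le_trans (fle _))// Hd.
Qed.

Lemma contractive_continuous (S S' : normedModType R) (f : S -> S') :
  (forall x y, f (x - y) = f x - f y) -> (forall x, `|f x| <= `|x|) ->
  continuous f.
Proof.
move=> fB fle x; apply/cvgrPdist_le => e e0; apply/nbhs_normP; exists e => //= y.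
by rewrite /ball_ /= -fB => /ltW; exact: le_trans.
Qed.

Lemma is_derive_diff_comp (S : normedModType R) (V : S -> R) z (t : R) v :
  differentiable V (z t) -> is_derive t 1 z v ->
  is_derive t 1 (V \o z) ('d V (z t) v).
Proof.
move=> dV dz; have dfz : differentiable z t by apply/derivable1_diffP; exact: ex_derive.
have dVz : differentiable (V \o z) t by exact: differentiable_comp.
apply: DeriveDef; first exact/derivable1_diffP.
rewrite deriveE// diff_comp//=.
congr ('d V (z t) _); rewrite -deriveE//.
by rewrite (derive_val (is_derive := dz)).
Qed.

End Coordinates.

(** * Dissipation in the density dynamics *)

Section Network.
Variables (R : realType) (n : nat) (N : traffic_network R n).
Hypothesis hN : network_assumptions N.

Definition total_lip (i : 'I_n) : R := len_ratio N i * flow_lip N i + unc_lip N i.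

Lemma total_flow_lip i x y : dens N i x -> dens N i y ->
  `|total_flow N i x - total_flow N i y| <= total_lip i * `|x - y|.
Proof.
move=> dx dy; have [_ pos _ fa ua] := hN.
have [_ _ _ _ fl] := fa i; have [_ [_ ul] _ _ _] := ua i.
have := fl (x, y) (conj dx dy); have := ul (x, y) (conj dx dy).
rewrite /self_sub /= => u f; have [_ L0 l0] := pos i.
have r0 : 0 <= len_ratio N i by rewrite divr_ge0// ltW.
rewrite /total_flow opprD addrACA -mulrBr (le_trans (ler_normD _ _))//.
by rewrite normrM (ger0_norm r0) mulrDl lerD// -mulrA ler_wpM2l.
Qed.

(** No sign is prescribed for [flow_lip]; it is the Lipschitz bound between the distinct points 0
    and [jam N i] that gives the sign. *)
Lemma total_lip_ge0 i : 0 <= total_lip i.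
Proof.
have [_ pos _ _ _] := hN; have [J0 _ _] := pos i.
have := @total_flow_lip i (jam N i) 0; rewrite /dens /= !in_itv/= !lexx (ltW J0).
move=> /(_ isT isT); rewrite subr0 (gtr0_norm J0) => h.
by rewrite -(pmulr_lge0 _ J0) (le_trans _ h).
Qed.

Lemma coupling_ge0 j i : edge N j i -> 0 <= coupling N j i.
Proof.
have [_ _ w _ _] := hN; have [_ wji _] := w j.
by move=> /wji w0; rewrite mulr_ge0// total_lip_ge0.
Qed.

(** [weight N i i] and the weights of the outgoing edges add up to 1. *)
Lemma net_inflowE rho u i : net_inflow N rho u i = - total_flow N i (rho 0 i)
  + \sum_(j | edge N j i) weight N j i * total_flow N j (rho 0 j) + u.
Proof.
have [_ _ w _ _] := hN; have [_ _ wi] := w i.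
by rewrite /net_inflow -mulr_suml mulNr -opprD -mulrDl wi mul1r.
Qed.

Lemma total_flow_continuous i x : 0 < x < jam N i ->
  {for x, continuous (total_flow N i)}.
Proof.
move=> /andP[x0 xJ]; apply/cvgrPdist_le => e e0.
have k0 : 0 < 1 + total_lip i by rewrite ltr_pwDl// total_lip_ge0.
have dx : dens N i x by rewrite /dens /= in_itv/= !ltW.
near=> y.
have dy : dens N i y.
  rewrite /dens /= in_itv/=; apply/andP; split; apply: ltW; near: y.
    exact: lt_nbhsr.
  exact: lt_nbhsl.
rewrite (le_trans (total_flow_lip dx dy))//.
have : `|x - y| <= e / (1 + total_lip i).
  by near: y; apply: cvgr_dist_le; [exact: cvg_id|rewrite divr_gt0].
rewrite ler_pdivlMr// => h; rewrite (le_trans _ h)// mulrC ler_wpM2l//.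
by rewrite lerDr.
Unshelve. all: by end_near.
Qed.

(** The margin in the gain condition, which becomes the decay coefficient of the squared density
    error of region [i]. *)
Definition slack (eta : 'I_n -> R) (xi : 'I_n -> 'I_n -> R) (i : 'I_n) : R :=
  eta i - (unc_lip N i + len_ratio N i * flow_lip N i
       + \sum_(j | edge N j i) coupling N j i / (2 * xi j i)
       + \sum_(j | edge N i j) xi i j * coupling N i j / 2).

(* Young's inequality [a x y <= a x^2 / (2 xi) + xi a y^2 / 2] distributes each
   coupling term over the two regions that it connects. *)
Lemma inflow_dissipation eta xi (rho rs : 'rV[R]_n) (u us : 'I_n -> R) :
  (forall j i, edge N j i -> 0 < xi j i) ->
  (forall i, dens N i (rho 0 i)) -> (forall i, dens N i (rs 0 i)) ->
  (forall i, net_inflow N rs (us i) i = 0) ->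
  \sum_i ((rho 0 i - rs 0 i) * net_inflow N rho (u i) i
     - (rho 0 i - rs 0 i) * (u i - us i) - eta i * (rho 0 i - rs 0 i) ^+ 2)
  <= - \sum_i slack eta xi i * (rho 0 i - rs 0 i) ^+ 2.
Proof.
move=> xi0 drho drs eqs.
pose D i := rho 0 i - rs 0 i.
have term i : D i * net_inflow N rho (u i) i - D i * (u i - us i)
    <= total_lip i * D i ^+ 2 + \sum_(j | edge N j i)
      (coupling N j i / (2 * xi j i) * D i ^+ 2 + xi j i * coupling N j i / 2 * D j ^+ 2).
  have -> : D i * net_inflow N rho (u i) i - D i * (u i - us i) =
      - (D i * (total_flow N i (rho 0 i) - total_flow N i (rs 0 i)))
      + \sum_(j | edge N j i) D i * (weight N j i *
          (total_flow N j (rho 0 j) - total_flow N j (rs 0 j))).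
    rewrite -mulr_sumr; under eq_bigr do rewrite mulrBr.
    have := eqs i; rewrite sumrB !net_inflowE.
    set G := \sum_(j | _) _; set G' := \sum_(j | _) _ => Eus.
    (* The equilibrium equation eliminates [us i], leaving only differences of flows. *)
    have -> : us i = total_flow N i (rs 0 i) - G by lra.
    by ring.
  apply: lerD.
    rewrite (le_trans (ler_norm _))// normrN normrM -real_normK ?num_real//.
    by rewrite expr2 mulrA mulrC ler_wpM2r// total_flow_lip.
  apply: ler_sum => j ji.
  have [_ _ w _ _] := hN; have [_ /(_ _ ji) w0 _] := w j.
  have x0 := xi0 _ _ ji.
  apply: (@le_trans _ _ (coupling N j i * (`|D i| * `|D j|))).
    rewrite (le_trans (ler_norm _))// !normrM (ger0_norm w0) mulrCA /coupling.
    rewrite -mulrA ler_wpM2l// mulrCA ler_wpM2l//.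
    by rewrite total_flow_lip.
  rewrite -[D i ^+ 2]real_normK ?num_real// -[D j ^+ 2]real_normK ?num_real//.
  have -> : coupling N j i / (2 * xi j i) * `|D i| ^+ 2
       + xi j i * coupling N j i / 2 * `|D j| ^+ 2 =
      coupling N j i * ((`|D i| ^+ 2 + (xi j i * `|D j|) ^+ 2) / (2 * xi j i)).
    by field; rewrite gt_eqF.
  rewrite ler_wpM2l ?coupling_ge0// ler_pdivlMr ?mulr_gt0//.
  have := sqr_ge0 (`|D i| - xi j i * `|D j|); nra.
apply: (@le_trans _ _ (\sum_i (total_lip i * D i ^+ 2 + \sum_(j | edge N j i)
      (coupling N j i / (2 * xi j i) * D i ^+ 2 + xi j i * coupling N j i / 2 * D j ^+ 2)
      - eta i * D i ^+ 2))).
  by apply: ler_sum => i _; rewrite lerD2r; exact: term.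
under eq_bigr do rewrite big_split/=.
rewrite big_split /= big_split /= big_split /=.
(* Swapping the sums charges the second term of each Young bound to the origin of its edge; hence
   the sum over successors in the gain condition. *)
have -> : \sum_i \sum_(j | edge N j i) xi j i * coupling N j i / 2 * D j ^+ 2 =
    \sum_i (\sum_(j | edge N i j) xi i j * coupling N i j / 2) * D i ^+ 2.
  by rewrite (exchange_big_dep predT)//=; apply: eq_bigr => i _; rewrite mulr_suml.
rewrite -!big_split /= -sumrN; apply: ler_sum => i _.
have -> : \sum_(j | edge N j i) coupling N j i / (2 * xi j i) * D i ^+ 2 =
    (\sum_(j | edge N j i) coupling N j i / (2 * xi j i)) * D i ^+ 2.
  by rewrite mulr_suml.
by rewrite /slack -/(D i) /total_lip; lra.
Qed.

End Network.

(** * Continuity of the closed-loop field *)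

Section Interconnection.
Variables (R : realType) (n : nat) (N : traffic_network R n) (C : vac_dynamics R n).
Hypotheses (hN : network_assumptions N) (hC : vac_assumptions N C).

Lemma vac_domain_nbhs i (x : 'rV[R]_(dimx C i)) s : - jam N i < s < 0 ->
  nbhs (x, s) (@vac_domain R n N C i).
Proof.
move=> /andP[Js s0].
have c2 : snd y @[y --> nbhs (x, s)] --> s by exact: cvg_snd.
apply: filterS2 (cvgr_gt _ c2 _ Js) (cvgr_lt _ c2 _ s0) => y /= Jy y0.
by split => //=; rewrite in_itv/= !ltW.
Qed.

Lemma chi_continuous i (x : 'rV[R]_(dimx C i)) s : - jam N i < s < 0 ->
  {for (x, s), continuous (chi C i)}.
Proof.
move=> Js; have nA := vac_domain_nbhs x Js; have Ap := nbhs_singleton nA.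
have [lip _ _] := hC i.
have [M M0] := pinfty_ex_gt0 (lip ((x, s), (x, s)) (conj Ap Ap)).
rewrite /within /= => HM.
(* The Lipschitz bound holds for pairs near a diagonal point; freezing the first member at [(x, s)]
   gives continuity there. *)
have cvp A : nbhs ((x, s), (x, s)) A -> \forall y \near (x, s), A ((x, s), y).
  move=> [[B1 B2] /= [n1 n2] sB]; apply: filterS n2 => y B2y.
  by apply: sB; split => //=; exact: nbhs_singleton.
apply/cvgrPdist_le => e e0.
have close : \forall y \near (x, s), `|(x, s) - y| <= e / M.
  by apply/nbhs_normP; exists (e / M); [rewrite /= divr_gt0|move=> y /ltW].
near=> y.
have HMy : `|chi C i (x, s) - chi C i y| <= M * `|(x, s) - y|.
  have : vac_domain N y by near: y.
  pose A := @vac_domain R n N C i.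
  move=> Ay; suff : (A `*` A) ((x, s), y) ->
     `|self_sub (chi C i) ((x, s), y)| <= M * `|self_sub id ((x, s), y)|.
    by apply; split.
  by near: y; exact: (cvp _ HM).
rewrite (le_trans HMy)// mulrC -ler_pdivlMr//.
by near: y.
Unshelve. all: by end_near.
Qed.

Lemma out_continuous i (x : 'rV[R]_(dimx C i)) s : - jam N i < s < 0 ->
  {for (x, s), continuous (out C i)}.
Proof.
move=> Js; have nA := vac_domain_nbhs x Js; have Ap := nbhs_singleton nA.
have [_ /subspace_continuousP/(_ _ Ap) co _] := hC i.
apply/cvgrPdist_le => e e0; have /cvgrPdist_le/(_ _ e0) := co.
by rewrite near_withinE; apply: filterS2 nA => y Ay; exact.
Qed.

Local Notation S := (state R n C).

Lemma density_continuous i : continuous (fun z : S => z.2 0 i).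
Proof.
move=> z; apply: (cvg_comp snd (fun y : 'rV[R]_n => y 0 i)); first exact: cvg_snd.
exact: coord_continuous.
Qed.

Lemma vac_state_continuous i : continuous (fun z : S => submxrow z.1 i).
Proof.
apply: contractive_continuous => [x y|x]; first by rewrite -submxrowB.
by rewrite (le_trans (submxrow_norm _ _))// prod_normE le_max lexx.
Qed.

(** Here the domains of the data are neighbourhoods of their arguments, so relative continuity is
    genuine continuity. This is the set [O] of [lasalle]. *)
Definition interior_states : set S := [set z : S | forall i, 0 < z.2 0 i < jam N i].

Lemma open_interior_states : open interior_states.
Proof.
rewrite openE => z zI.
apply: (@filter_forall S _ (fun i => [set y : S | 0 < y.2 0 i < jam N i]) (nbhs z)).
move=> i; have /andP[z0 zJ] := zI i.
have ci := @density_continuous i z.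
by apply: filterS2 (cvgr_gt _ ci _ z0) (cvgr_lt _ ci _ zJ) => y /= -> ->.
Qed.

Lemma interior_statesW : interior_states `<=` state_space N C.
Proof.
by move=> z zI i; have /andP[z0 zJ] := zI i; rewrite /dens /= in_itv/= !ltW.
Qed.

Lemma vector_field_continuous z : interior_states z ->
  {for z, continuous (vector_field N C)}.
Proof.
move=> zI; have arg i : (fun y : S => (submxrow y.1 i, - y.2 0 i)) @ z
    --> (submxrow z.1 i, - z.2 0 i).
  apply: (@continuous_pair S _ _ (fun y => submxrow y.1 i) (fun y => - y.2 0 i)).
    exact: vac_state_continuous.
  by apply: cvgN; exact: density_continuous.
have Js i : - jam N i < - z.2 0 i < 0.
  by rewrite ltrN2 oppr_lt0 andbC; exact: zI.
have flowc i : (fun y : S => total_flow N i (y.2 0 i)) @ z --> total_flow N i (z.2 0 i).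
  apply: (cvg_comp (fun y : S => y.2 0 i) (total_flow N i)).
    exact: density_continuous.
  exact: total_flow_continuous.
apply: continuous_pair.
  apply: cvg_mxrow => i; apply: (cvg_comp _ (chi C i) (arg i)).
  exact: chi_continuous.
apply: cvg_row => i; apply: cvgMl_tmp; apply: cvgD; last first.
  by apply: (cvg_comp _ (out C i) (arg i)); exact: out_continuous.
apply: cvgD; last by apply: cvg_sum => j _; apply: cvgMl_tmp.
by apply: cvgB; [apply: cvgMl_tmp|apply: cvg_sum => j _; apply: cvgMl_tmp].
Qed.

Lemma state_compact_ball (p : S) r : compact [set x | `|x - p| <= r].
Proof. by apply: pair_compact_ball => q s; exact: row_compact_ball. Qed.

Section Trajectories.
Variables (z : R -> S) (t : R).
Hypothesis dz : is_derive t 1 z (vector_field N C (z t)).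

Lemma vac_state_derive i : is_derive t 1 (fun s => submxrow (z s).1 i)
  (chi C i (submxrow (z t).1 i, - (z t).2 0 i)).
Proof.
have := @is_derive_linear_comp R S _ (fun z : S => submxrow z.1 i) z t _ _ _ _ dz.
rewrite /= mxrowK; apply => [x y|a x|x].
- by rewrite -submxrowB.
- by apply/matrixP => k l; rewrite !mxE.
- by rewrite (le_trans (submxrow_norm _ _))// prod_normE le_max lexx.
Qed.

Lemma density_derive i : is_derive t 1 (fun s => (z s).2 0 i)
  ((len N i)^-1 * net_inflow N (z t).2
     (out C i (submxrow (z t).1 i, - (z t).2 0 i)) i).
Proof.
have := @is_derive_linear_comp R S R (fun z : S => z.2 0 i) z t _ _ _ _ dz.
rewrite /= mxE; apply => [x y|a x|x].
- by rewrite !mxE.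
- by rewrite !mxE.
- by rewrite (le_trans (row_norm_coord _ _))// prod_normE le_max lexx orbT.
Qed.

End Trajectories.
End Interconnection.

(** * The composite Lyapunov function *)

Section Equilibrium.
Variables (R : realType) (n : nat) (N : traffic_network R n) (C : vac_dynamics R n).
Hypotheses (hN : network_assumptions N) (hC : vac_assumptions N C).
Variables (xs : 'rV[R]_(\sum_(i < n) dimx C i)) (rs : 'rV[R]_n).
Hypothesis heq : equilibria N C (xs, rs).
Local Notation S := (state R n C).

(** The choice in [static_state] does select a zero, as [vac_assumptions] provides one. *)
Lemma equilibrium_chi0 i : chi C i (submxrow xs i, - rs 0 i) = 0.
Proof.
have [/= drs _ ->] := heq i; have [_ _ st] := hC i.
have [[x [x0 _]] _] := st _ drs.
rewrite /static_state.
by apply: (@getPex _ [set x | chi C i (x, - rs 0 i) = 0]); exists x.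
Qed.

Lemma equilibrium_inflow i :
  net_inflow N rs (out C i (submxrow xs i, - rs 0 i)) i = 0.
Proof. by have [/= _ + ->] := heq i. Qed.

(** A trajectory on the whole line restricts to a maximal solution, as no time exceeds [+oo]; the
    assumed local asymptotic stability thus applies to it. *)
Lemma vac_attraction i : exists d, 0 < d /\
  forall x : R -> 'rV[R]_(dimx C i),
    (forall t : R, is_derive t 1 x (chi C i (x t, - rs 0 i))) ->
    `|x 0 - submxrow xs i| < d -> x t @[t --> +oo] --> submxrow xs i.
Proof.
have [/= drs _ _] := heq i; have [_ _ st] := hC i.
have [_ /(_ _ (equilibrium_chi0 i))[_ [d d0 Hd]]] := st _ drs.
exists d; split => // x dx xd; have [|//] := Hd +oo%E x _ xd.
split; last by move=> T' z'; rewrite ltNge leey.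
apply: slope_solution => // t _; split => //.
by apply: has_slope_sub (proj1 (is_derive_slope _ _ _) (dx t)).
Qed.

(** Passivity as a neighbourhood property of the full state, with the margin replaced by its
    quadratic lower bound. *)
Definition local_storage i eta (V : 'rV[R]_(dimx C i) -> R) : Prop :=
  [/\ forall x, differentiable V x, V (submxrow xs i) = 0,
      forall x, x != submxrow xs i -> 0 < V x &
      nbhs ((xs, rs) : S) [set z : S | dens N i (z.2 0 i) ->
        'd V (submxrow z.1 i) (chi C i (submxrow z.1 i, - z.2 0 i)) <=
        - ((z.2 0 i - rs 0 i) * (out C i (submxrow z.1 i, - z.2 0 i) -
             out C i (submxrow xs i, - rs 0 i)))
        - eta * (z.2 0 i - rs 0 i) ^+ 2]].

Lemma passive_storage i eta :
  input_strictly_passive N C i (submxrow xs i) (rs 0 i) eta ->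
  exists V : 'rV[R]_(dimx C i) -> R, local_storage eta V.
Proof.
move=> [_ [X [U [V [theta [[oX Xx oU Uu] [[dV _] V0 Vpos] _ th diss]]]]]].
exists V; split => //.
have nX : nbhs (submxrow xs i) X by apply: open_nbhs_nbhs.
have nU : nbhs (- rs 0 i) U by apply: open_nbhs_nbhs.
have cX : nbhs ((xs, rs) : S) [set z : S | X (submxrow z.1 i)].
  exact: (@vac_state_continuous R n C i (xs, rs) _ nX).
have cU : nbhs ((xs, rs) : S) [set z : S | U (- z.2 0 i)].
  have cd : (fun z : S => - z.2 0 i) @ ((xs, rs) : S) --> - rs 0 i.
    by apply: cvgN; exact: (@density_continuous R n C i (xs, rs)).
  exact: cd _ nU.
apply: filterS2 cX cU => z /= Xz Uz dz.
have := diss _ _ dz Uz Xz; have := th _ dz Uz; rewrite mulrBr; nra.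
Qed.

Section Storage.
Variable V : forall i, 'rV[R]_(dimx C i) -> R.
Arguments V : clear implicits.
Hypothesis dV : forall i x, differentiable (V i) x.
Hypothesis V0 : forall i, V i (submxrow xs i) = 0.
Hypothesis Vpos : forall i x, x != submxrow xs i -> 0 < V i x.

(* Weighting the squared density error by [len N i] makes the terms with the
   control input cancel against the supply rates of the passivity inequalities. *)
Definition storage_term (i : 'I_n) (z : S) : R :=
  len N i / 2 * ((z.2 0 i - rs 0 i) * (z.2 0 i - rs 0 i)) + V i (submxrow z.1 i).

Definition total_storage (z : S) : R := \sum_i storage_term i z.

Lemma total_storage_continuous : continuous total_storage.
Proof.
move=> z; apply: cvg_sum => i _; apply: cvgD; last first.
  apply: (cvg_comp (fun z : S => submxrow z.1 i) (V i)).
    exact: vac_state_continuous.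
  exact: differentiable_continuous (dV (submxrow z.1 i)).
have cd : (fun y : S => y.2 0 i - rs 0 i) @ z --> z.2 0 i - rs 0 i.
  by apply: cvgB; [exact: density_continuous|exact: cvg_cst].
by apply: cvgMl_tmp; apply: cvgM.
Qed.

Lemma total_storage0 : total_storage (xs, rs) = 0.
Proof.
by apply: big1 => i _; rewrite /storage_term /= subrr !mulr0 V0 addr0.
Qed.

Lemma storage_term_ge0 i z : 0 <= storage_term i z.
Proof.
have [_ pos _ _ _] := hN; have [_ L0 _] := pos i.
apply: addr_ge0; first by rewrite mulr_ge0 ?divr_ge0 ?(ltW L0)// -expr2 sqr_ge0.
by have [->|/Vpos/ltW//] := eqVneq (submxrow z.1 i) (submxrow xs i); rewrite V0.
Qed.

(** If the sum vanishes, so does each of its non-negative terms, which fixes the density and then,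
    by definiteness of [V i], the VAC state. *)
Lemma total_storage_gt0 z : z != (xs, rs) -> 0 < total_storage z.
Proof.
have [_ pos _ _ _] := hN.
rewrite lt_neqAle sumr_ge0 ?andbT//; last by move=> i _; exact: storage_term_ge0.
apply: contraNneq => /esym/psumr_eq0P W0.
have W0i i : storage_term i z = 0 by apply: W0 => // j _; exact: storage_term_ge0.
have rhoE i : z.2 0 i = rs 0 i.
  have [_ L0 _] := pos i; apply/eqP; rewrite -subr_eq0.
  apply: contra_eqT (W0i i) => rho; rewrite gt_eqF//; apply: ltr_pwDl.
    by rewrite mulr_gt0 ?divr_gt0// -expr2 exprn_even_gt0.
  by have [->|/Vpos/ltW//] := eqVneq (submxrow z.1 i) (submxrow xs i); rewrite V0.
have xE i : submxrow z.1 i = submxrow xs i.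
  apply/eqP; apply: contra_eqT (W0i i) => xi.
  by rewrite /storage_term rhoE subrr !mulr0 add0r gt_eqF// Vpos.
apply/eqP; rewrite [z]surjective_pairing; congr pair.
  by apply/mxrowP => i; exact: xE.
by apply/rowP => i.
Qed.

Lemma total_storage_derive (z : R -> S) (t : R) :
  is_derive t 1 z (vector_field N C (z t)) ->
  is_derive t 1 (total_storage \o z) (\sum_i
    (((z t).2 0 i - rs 0 i) * net_inflow N (z t).2
        (out C i (submxrow (z t).1 i, - (z t).2 0 i)) i
     + 'd (V i) (submxrow (z t).1 i)
         (chi C i (submxrow (z t).1 i, - (z t).2 0 i)))).
Proof.
move=> dz; have [_ pos _ _ _] := hN.
have -> : total_storage \o z = \sum_i (storage_term i \o z).
  by apply/funext => s; rewrite fct_sumE.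
apply: is_derive_sum => i; have [_ L0 _] := pos i.
have dx := is_derive_diff_comp (@dV i _) (vac_state_derive dz i).
have dr := is_deriveB (density_derive dz i) (is_derive_cst (rs 0 i) t 1).
apply: (is_derive_eq (is_deriveD (is_deriveZ (len N i / 2) (is_deriveM dr dr)) dx)).
congr (_ + _).
rewrite subr0 /GRing.scale /= (_ : (_ - cst _) t = (z t).2 0 i - rs 0 i)//.
(* The factor [len N i / 2] cancels both the 2 from the square and the inverse length in the
   field. *)
by field; rewrite gt_eqF.
Qed.

End Storage.
End Equilibrium.

Theorem theorem1 (R : realType) (n : nat) (hn : (2 <= n)%N)
  (N : traffic_network R n) (C : vac_dynamics R n)
  (hN : network_assumptions N) (hC : vac_assumptions N C)
  (xs : 'rV[R]_(\sum_(i < n) dimx C i)) (rs : 'rV[R]_n)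
  (heq : equilibria N C (xs, rs))
  (hint : forall i, - jam N i < - rs 0 i < 0)
  (eta : 'I_n -> R)
  (hpass : forall i,
     input_strictly_passive N C i (submxrow xs i) (rs 0 i) (eta i))
  (hgain : exists xi : 'I_n -> 'I_n -> R,
     (forall j i, edge N j i -> 0 < xi j i) /\
     forall i, unc_lip N i + len_ratio N i * flow_lip N i
       + \sum_(j | edge N j i) coupling N j i / (2 * xi j i)
       + \sum_(j | edge N i j) xi i j * coupling N i j / 2 < eta i) :
  exists M : set (state R n C),
    [/\ open M, M (xs, rs) &
        forall (T : \bar R)
          (z : R -> state R n C),
          maximal_solution (vector_field N C) (state_space N C) T z ->
          M (z 0) ->
          T = +oo%E /\ converges_to_set z (equilibria N C)].
Proof.
case: hgain => xi [xi0 gain].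
have c0 i : 0 < slack N eta xi i by rewrite subr_gt0.
have [V HV] : exists V : forall i, 'rV[R]_(dimx C i) -> R,
    forall i, local_storage N xs rs (eta i) (V i).
  exists (fun i => sval (cid (passive_storage (hpass i)))) => i.
  exact: svalP (cid (passive_storage (hpass i))).
have [d Hd] := choice (fun i => vac_attraction hC heq i).
pose S : normedModType R := (state R n C).
pose e : S := (xs, rs).
have eI : interior_states N e.
  by move=> i; have := hint i; rewrite ltrN2 oppr_lt0 andbC.
(* All that is required of region [i] near the equilibrium: an interior density, a VAC state within
   the attraction radius at constant input, and dissipation. *)
pose good i := [set z : S | [/\ 0 < z.2 0 i < jam N i,
  `|submxrow z.1 i - submxrow xs i| < d i &
  'd (V i) (submxrow z.1 i) (chi C i (submxrow z.1 i, - z.2 0 i)) <=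
        - ((z.2 0 i - rs 0 i) * (out C i (submxrow z.1 i, - z.2 0 i) -
             out C i (submxrow xs i, - rs 0 i)))
        - eta i * (z.2 0 i - rs 0 i) ^+ 2]].
have near_good : nbhs e [set z | forall i, good i z].
  apply: (@filter_forall S _ good (nbhs e)) => i; have [_ _ _ Hi] := HV i.
  have nI : nbhs e (@interior_states R n N C).
    by apply: open_nbhs_nbhs; split => //; exact: open_interior_states.
  have [d0 _] := Hd i.
  have nd : nbhs e [set z : S | `|submxrow z.1 i - submxrow xs i| < d i].
    have /cvgrPdist_lt/(_ _ d0) := @vac_state_continuous R n C i e.
    by apply: filterS => z; rewrite distrC.
  apply: filterS3 nI nd Hi => z zI zd zV; split => //.
  by apply: zV; exact: interior_statesW zI i.
have /nbhs_normP[r0 /= r00 Hr0] := near_good.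
pose r := r0 / 2.
have r_gt0 : 0 < r by rewrite divr_gt0.
have Hr (z : S) : `|z - e| <= r -> forall i, good i z.
  move=> zr; apply: Hr0; rewrite /ball_ /= distrC (le_lt_trans zr)//.
  by rewrite /r ltr_pdivrMr// ltr_pMr// ltr1n.
have BI : [set z : S | `|z - e| <= r] `<=` @interior_states R n N C.
  by move=> z /Hr zg i; have [] := zg i.
have BD (z : S) i : `|z - e| <= r -> dens N i (z.2 0 i).
  by move=> /BI/(@interior_statesW R n N C); exact.
have drs i : dens N i (rs 0 i) by have [] := heq i.
have dV i x : differentiable (V i) x by have [] := HV i.
have V0 i : V i (submxrow xs i) = 0 by have [] := HV i.
have Vpos i x : x != submxrow xs i -> 0 < V i x by have [_ _ + _] := HV i; exact.
have Wpos (z : S) : z != e -> 0 < total_storage N rs V z.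
  by move=> /eqP ze; apply: (total_storage_gt0 hN V0 Vpos); apply/eqP.
pose Q (z : S) := \sum_i slack N eta xi i * (z.2 0 i - rs 0 i) ^+ 2.
have Qterm (z : S) i : 0 <= slack N eta xi i * (z.2 0 i - rs 0 i) ^+ 2.
  by rewrite mulr_ge0 ?sqr_ge0 ?ltW.
have [|z t zr dz|z Hz|M [oM Me HM]] := @lasalle R S (vector_field N C) (state_space N C)
  (@interior_states R n N C) (total_storage N rs V) Q e r
  (@state_compact_ball R n C) (@open_interior_states R n N C)
  (@interior_statesW R n N C) (vector_field_continuous hN hC) r_gt0 BI
  (total_storage_continuous dV) (total_storage0 N rs V0)
  Wpos.
- by move=> z _; apply: sumr_ge0 => i _; exact: Qterm.
- exists (\sum_i (((z t).2 0 i - rs 0 i) * net_inflow N (z t).2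
        (out C i (submxrow (z t).1 i, - (z t).2 0 i)) i
     + 'd (V i) (submxrow (z t).1 i)
         (chi C i (submxrow (z t).1 i, - (z t).2 0 i)))).
    exact: total_storage_derive.
  have := @inflow_dissipation R n N hN eta xi (z t).2 rs
    (fun i => out C i (submxrow (z t).1 i, - (z t).2 0 i))
    (fun i => out C i (submxrow xs i, - rs 0 i)) xi0
    (fun i => BD _ i zr) drs (equilibrium_inflow heq).
  (* The storage inequality bounds the derivative of [V i] by minus the supply and the margin, which
     is what [inflow_dissipation] has in its summand. *)
  apply: le_trans; apply: ler_sum => i _; have [_ _ h] := Hr _ zr i.
  by rewrite -addrA lerD2l.
- have rhoE t i : (z t).2 0 i = rs 0 i.
    have [zr Qz _] := Hz t.
    have /psumr_eq0P : Q (z t) = 0 by [].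
    move=> /(_ (fun i _ => Qterm (z t) i)) /(_ i isT)/eqP.
    by rewrite mulf_eq0 gt_eqF//= sqrf_eq0 subr_eq0 => /eqP.
  (* At constant density [vac_attraction] applies, since the ball lies within every attraction
     radius. *)
  have xE i : submxrow (z t).1 i @[t --> +oo] --> submxrow xs i.
    have [_] := Hd i; apply => [t|].
      by have [_ _ dz] := Hz t; have := vac_state_derive dz i; rewrite rhoE.
    by have [zr _ _] := Hz 0; have [] := Hr _ zr i.
  have : (fun t => (\mxrow_i submxrow (z t).1 i, rs)) @ +oo -->
      (\mxrow_i submxrow xs i, rs).
    by apply: cvg_to_pair; [exact: cvg_mxrow|exact: cvg_cst].
  rewrite submxrowK (_ : (fun t => _) = z)//; apply/funext => t.
  by rewrite submxrowK [RHS]surjective_pairing; congr pair; apply/rowP => i.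
exists M; split => // T z maxz Mz; have [TE ze] := HM T z maxz Mz; split => //.
move=> h h0; have := ze; move=> /cvgrPdistC_lt/(_ _ h0).
by apply: filterS => t zt; exists (xs, rs).
Qed.
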